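(* Assume that the data satisfy $$\frac14\Big(1+\frac{16}{\alpha_S^2\alpha_T^2}\|\mathbf g\|_{0,3/2;\Omega}\|\varphi_D\|^2_{1/2,\Gamma_D}\Big)\|\mathbf g\|_{0,3/2;\Omega}+C_2\Big(\|\varphi_D\|_{1/2+\epsilon,\Gamma_D}+\frac{8}{\alpha_S\alpha_T^2}\|\mathbf g\|_{0,3/2;\Omega}\|\varphi_D\|_{1/2,\Gamma_D}^2\Big)\le\frac14$$ and $$\frac{1}{\alpha_S\alpha_T}\|\varphi_D\|_{1/2,\Gamma_D}\|\mathbf g\|_{0,3/2;\Omega}+C_2\frac1{\alpha_T}\|\varphi_D\|_{1/2,\Gamma_D}\le\frac1{8C_1}.$$ Then there exists a constant $\widehat C>0$, depending only on $C_1$ and $C_2$, and hence independent of $h$, such that $$\begin{aligned}\|(\boldsymbol\sigma,\vec{\mathbf u})-(\boldsymbol\sigma_h,\vec{\mathbf u}_h)\|_{\mathcal V}&+\|(\boldsymbol\rho,\varphi)-(\boldsymbol\rho_h,\varphi_h)\|_{\mathcal W}\le\widehat C\Big\{\mathrm{dist}\big((\boldsymbol\sigma,\vec{\mathbf u}),\mathcal V_h\big)+\mathrm{dist}\big((\boldsymbol\rho,\varphi),\mathcal W_h\big)\\&+\|\boldsymbol\sigma-\mathcal P^h_r(\boldsymbol\sigma)\|_{0,\Omega}+\|\boldsymbol\gamma-\mathcal P^h_r(\boldsymbol\gamma)\|_{0,\Omega}+\|\mathbf u\otimes\mathbf u-\mathcal P^h_r(\mathbf u\otimes\mathbf u)\|_{0,\Omega}\\&+\|\boldsymbol\rho-\mathcal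 P^h_r(\boldsymbol\rho)\|_{0,\Omega}+\|\varphi\mathbf u-\mathcal P^h_r(\varphi\mathbf u)\|_{0,\Omega}\Big\}.\end{aligned}$$
   Context: **Data.** $\Omega\subset\mathbb R^2$ is a bounded polygonal domain with boundary $\Gamma=\Gamma_D\cup\Gamma_N$ and outward unit normal $\mathbf n$; $\mathbf g\in L^\infty(\Omega)^2$; $\varphi_D\in H^{1/2}(\Gamma_D)$. $\mu,\kappa:\mathbb R\to\mathbb R^+$ satisfy $\mu_1\le\mu\le\mu_2$, $\kappa_1\le\kappa\le\kappa_2$ with positive constants and are Lipschitz with constants $L_\mu,L_\kappa$. $\|\cdot\|_{0,p;\Omega}$ is the $L^p$ norm and $\|\cdot\|_{0,\Omega}$ the $L^2$ norm. $\boldsymbol\tau^{\mathtt d}=\boldsymbol\tau-\frac12\mathrm{tr}(\boldsymbol\tau)\mathbb I$, $(\mathbf z\otimes\mathbf w)_{ij}=z_iw_j$; $\mathbf{div}$, $\mathbf{rot}$ act row-wise, $\mathrm{rot}(\boldsymbol\eta)=\partial_x\eta_2-\partial_y\eta_1$. **Continuous spaces.** $\mathbb X=\{\boldsymbol\tau\in L^2(\Omega)^{2\times2}:\mathbf{div}(\boldsymbol\tau)\in L^{6/5}(\Omega)^2,\int_\Omega\mathrm{tr}(\boldsymbol\tau)=0\}$, norm $\|\boldsymbol\tau\|_{\mathbf{div}_{6/5},\Omega}=\|\boldsymbol\tau\|_{0,\Omega}+\|\mathbf{div}(\boldsymbol\tau)\|_{0,6/5;\Omega}$; $\mathbf X=\{\boldsymbol\eta\in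 L^2(\Omega)^2:\mathrm{div}(\boldsymbol\eta)\in L^{6/5}(\Omega),\boldsymbol\eta\cdot\mathbf n=0\text{ on }\Gamma_N\}$, norm $\|\boldsymbol\eta\|_{\mathrm{div}_{6/5},\Omega}=\|\boldsymbol\eta\|_{0,\Omega}+\|\mathrm{div}(\boldsymbol\eta)\|_{0,6/5;\Omega}$; $\mathbf Y=L^6(\Omega)^2$, $\mathrm Y=L^6(\Omega)$, $\mathbb Z$ = skew-symmetric tensors in $L^2(\Omega)^{2\times2}$, $\mathcal Z=\mathbf Y\times\mathbb Z\ni\vec{\mathbf v}=(\mathbf v,\boldsymbol\omega)$ with norm $\|\mathbf v\|_{0,6;\Omega}+\|\boldsymbol\omega\|_{0,\Omega}$. $\mathcal V=\mathbb X\times\mathcal Z$, $\mathcal W=\mathbf X\times\mathrm Y$, with sum norms. **Continuous forms and problem (P).** $A^S_\phi(\boldsymbol\zeta,\boldsymbol\tau)=\int_\Omega\frac1{\mu(\phi)}\boldsymbol\zeta^{\mathtt d}:\boldsymbol\tau^{\mathtt d}$, $O^S_\phi(\mathbf z;\mathbf w,\boldsymbol\tau)=\int_\Omega\frac1{\mu(\phi)}(\mathbf z\otimes\mathbf w)^{\mathtt d}:\boldsymbol\tau$, $B^S(\boldsymbol\tau,\vec{\mathbf v})=\int_\Omega\mathbf v\cdot\mathbf{div}(\boldsymbol\tau)+\int_\Omega\boldsymbol\omega:\boldsymbol\tau$, $A^T_\phi(\boldsymbol\xi,\boldsymbol\eta)=\int_\Omega\frac1{\kappa(\phi)}\boldsymbol\xi\cdot\boldsymbol\eta$,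 $O^T_\phi(\mathbf z;\omega,\boldsymbol\eta)=\int_\Omega\frac1{\kappa(\phi)}\omega\,\mathbf z\cdot\boldsymbol\eta$, $B^T(\boldsymbol\eta,\psi)=\int_\Omega\psi\,\mathrm{div}(\boldsymbol\eta)$, $F^T(\boldsymbol\eta)=\langle\boldsymbol\eta\cdot\mathbf n,\varphi_D\rangle_{\Gamma_D}$, where the norm on $H^{1/2}(\Gamma_D)$ is normalized so that $|F^T(\boldsymbol\eta)|\le\|\varphi_D\|_{1/2,\Gamma_D}\|\boldsymbol\eta\|_{\mathrm{div}_{6/5},\Omega}$. (P): for all test functions, $A^S_\varphi(\boldsymbol\sigma,\boldsymbol\tau)+O^S_\varphi(\mathbf u;\mathbf u,\boldsymbol\tau)+B^S(\boldsymbol\tau,\vec{\mathbf u})=0$; $B^S(\boldsymbol\sigma,\vec{\mathbf v})=-\int_\Omega\varphi\,\mathbf g\cdot\mathbf v$; $A^T_\varphi(\boldsymbol\rho,\boldsymbol\eta)+O^T_\varphi(\mathbf u;\varphi,\boldsymbol\eta)+B^T(\boldsymbol\eta,\varphi)=F^T(\boldsymbol\eta)$; $B^T(\boldsymbol\rho,\psi)=0$. $\alpha_S,\alpha_T>0$ are inf-sup constants, independent of $\phi\in\mathrm Y$: $\sup\frac{A^S_\phi(\boldsymbol\zeta,\boldsymbol\tau)+B^S(\boldsymbol\tau,\vec{\mathbf w})+B^S(\boldsymbol\zeta,\vec{\mathbf v})}{\|(\boldsymbol\tau,\vec{\mathbf v})\|}\ge\alpha_S\|(\boldsymbol\zeta,\vec{\mathbf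 w})\|$ on $\mathcal V$, $\sup\frac{A^T_\phi(\boldsymbol\xi,\boldsymbol\eta)+B^T(\boldsymbol\eta,\omega)+B^T(\boldsymbol\xi,\psi)}{\|(\boldsymbol\eta,\psi)\|}\ge\alpha_T\|(\boldsymbol\xi,\omega)\|$ on $\mathcal W$. $R=\min\{\frac{\mu_1\alpha_S}{2|\Omega|^{1/6}},\frac{\kappa_1\alpha_T}{2|\Omega|^{1/6}}\}$, $\mathbf W(R)=\{(\mathbf z,\phi)\in\mathbf Y\times\mathrm Y:\|\mathbf z\|_{0,6;\Omega}+\|\phi\|_{0,6;\Omega}\le R\}$. **Discrete spaces.** $\{\Omega_h\}$ are partitions of $\Omega$ into polygons $E$ of diameter $h_E$, $h=\max h_E$, such that for some $\rho>0$ independent of $h$ every $E$ is star-shaped w.r.t. every point of a disk of radius $\rho h_E$ and every edge of $E$ has length $\ge\rho h_E$. $r\ge0$ is a fixed integer; $P_{-1}=\{0\}$. $\mathcal P^E_l:L^1(E)\to P_l(E)$: $\int_E(\mathcal P^E_lv-v)q=0$ for all $q\in P_l(E)$ (componentwise for vectors, tensors); $\mathcal P^h_r|_E=\mathcal P^E_r$. $\mathbf X_r^E$: all $\boldsymbol\eta\in L^2(E)^2$ with $\mathrm{div}\,\boldsymbol\eta\in P_r(E)$, $\mathrm{rot}\,\boldsymbol\eta\in P_{r-1}(E)$, $\boldsymbol\eta\cdot\mathbf n|_e\in P_r(e)$ on each edge; $\mathbb X_r^E$: tensors with rows in $\mathbf X_r^E$. $\mathbf X_h\subset\mathbf X$,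 $\mathbb X_h\subset\mathbb X$ consist of functions whose restrictions to each $E$ lie in $\mathbf X_r^E$, $\mathbb X_r^E$; $\mathrm Y_h,\mathbf Y_h$ are scalar/vector piecewise $P_r$ functions; $\mathbb Z_h$ skew-symmetric piecewise $P_r$ tensors; $\mathcal Z_h=\mathbf Y_h\times\mathbb Z_h$; $\mathcal V_h=\mathbb X_h\times\mathcal Z_h$, $\mathcal W_h=\mathbf X_h\times\mathrm Y_h$. $\mathrm{dist}(v,V_h)=\inf_{v_h\in V_h}\|v-v_h\|_V$. **Discrete forms and scheme $(P_h)$.** With local forms $A^{S,E}_\phi,A^{T,E}_\phi$ (integrals over $E$): $A^S_{h,\phi}(\boldsymbol\zeta,\boldsymbol\tau)=\sum_E[A^{S,E}_\phi(\mathcal P^E_r\boldsymbol\zeta,\mathcal P^E_r\boldsymbol\tau)+\mathscr S^{S,E}_\phi(\boldsymbol\zeta-\mathcal P^E_r\boldsymbol\zeta,\boldsymbol\tau-\mathcal P^E_r\boldsymbol\tau)]$, $A^T_{h,\phi}$ analogous; $O^S_{h,\phi}(\mathbf z;\mathbf w,\boldsymbol\tau)=\sum_E\int_E\frac1{\mu(\phi)}(\mathbf z\otimes\mathbf w)^{\mathtt d}:\mathcal P^E_r\boldsymbol\tau$; $O^T_{h,\phi}(\mathbf z;\omega,\boldsymbol\eta)=\sum_E\int_E\frac1{\kappa(\phi)}\omega\,\mathbf z\cdot\mathcal P^E_r\boldsymbol\eta$; $B^S_h(\boldsymbol\tau,\vec{\mathbf v})=\sum_E[\int_E\mathbf v\cdot\mathbf{div}(\boldsymbol\tau)+\int_E\boldsymbol\omega:\mathcal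 P^E_r\boldsymbol\tau]$. Here $\mathscr S^{S,E}_\phi(\boldsymbol\zeta,\boldsymbol\tau)=\frac1{|\mu(\mathcal P^E_0\phi)|}\sum_k\mathscr M^{S,E}_k(\boldsymbol\zeta)\mathscr M^{S,E}_k(\boldsymbol\tau)$, $\mathscr S^{T,E}_\phi(\boldsymbol\xi,\boldsymbol\eta)=\frac1{|\kappa(\mathcal P^E_0\phi)|}\sum_k\mathscr M^{T,E}_k(\boldsymbol\xi)\mathscr M^{T,E}_k(\boldsymbol\eta)$, where $\mathscr M^{T,E}_k$ are the degrees of freedom of $\mathbf X_r^E$ (moments $\int_e(\boldsymbol\eta\cdot\mathbf n)q$, $q\in P_r(e)$; $\int_E\boldsymbol\eta\cdot\nabla q$, $q\in P_r(E)$ nonconstant; $\int_E\boldsymbol\eta\cdot\mathbf q$, $\mathbf q\in\mathbf P_r^\perp(E)$ with $P_r(E)^2=\nabla P_{r+1}(E)\oplus\mathbf P_r^\perp(E)$; over bases) and $\mathscr M^{S,E}_k$ their row-wise analogues on $\mathbb X_r^E$; these stabilizations are equivalent, uniformly in $h$ and $\phi\in\mathrm Y_h$, to $A^{S,E}_\phi$, $A^{T,E}_\phi$ on the kernels of $\mathcal P^E_r$ in $\mathbb X_r^E$, $\mathbf X_r^E$. $(P_h)$: for all discrete test functions, $A^S_{h,\varphi_h}(\boldsymbol\sigma_h,\boldsymbol\tau_h)+O^S_{h,\varphi_h}(\mathbf u_h;\mathbf u_h,\boldsymbol\tau_h)+B^S_h(\boldsymbol\tau_h,\vec{\mathbf u}_h)=0$;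 $B^S_h(\boldsymbol\sigma_h,\vec{\mathbf v}_h)=-\int_\Omega\varphi_h\mathbf g\cdot\mathbf v_h$; $A^T_{h,\varphi_h}(\boldsymbol\rho_h,\boldsymbol\eta_h)+O^T_{h,\varphi_h}(\mathbf u_h;\varphi_h,\boldsymbol\eta_h)+B^T(\boldsymbol\eta_h,\varphi_h)=F^T(\boldsymbol\eta_h)$; $B^T(\boldsymbol\rho_h,\psi_h)=0$. $\alpha_{S,h},\alpha_{T,h}>0$ (independent of $h$ and of $\phi_h\in\mathrm Y_h$) are the analogous inf-sup constants of $A^S_{h,\phi_h}+B^S_h+B^S_h$ on $\mathcal V_h$ and $A^T_{h,\phi_h}+B^T+B^T$ on $\mathcal W_h$; $R_{\mathtt d}=\min\{\frac{\mu_1\alpha_{S,h}}{2|\Omega|^{1/6}},\frac{\kappa_1\alpha_{T,h}}{2|\Omega|^{1/6}}\}$; $\mathbf W_{\mathtt d}$ is the closed ball of radius $R_{\mathtt d}$ centred at $0$ in $\mathbf Y_h\times\mathrm Y_h$ (sum of $L^6$ norms). **Standing assumptions.** There are $\epsilon\in[\frac13,1)$ and $C_\epsilon,\widetilde C_\epsilon>0$ with $\varphi_D\in H^{1/2+\epsilon}(\Gamma_D)$ such that: for $\|\mathbf z\|_{0,6;\Omega}\le\frac{\mu_1\alpha_S}{2|\Omega|^{1/6}}$ and $\phi\in\mathrm Y$, the solution $(\boldsymbol\sigma_\star,(\mathbf u_\star,\boldsymbol\gamma_\star))\in\mathcal V$ of $A^S_\phi(\boldsymbol\sigma_\star,\boldsymbol\tau)+O^S_\phi(\mathbf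 z;\mathbf u_\star,\boldsymbol\tau)+B^S(\boldsymbol\tau,\vec{\mathbf u}_\star)=0$, $B^S(\boldsymbol\sigma_\star,\vec{\mathbf v})=-\int_\Omega\phi\mathbf g\cdot\mathbf v$ satisfies $\|\boldsymbol\sigma_\star\|_{\epsilon,\Omega}+\|\mathbf u_\star\|_{\epsilon,6;\Omega}\le C_\epsilon\|\mathbf g\|_{0,3/2;\Omega}\|\phi\|_{0,6;\Omega}$; for $\|\mathbf z\|_{0,6;\Omega}\le\frac{\kappa_1\alpha_T}{2|\Omega|^{1/6}}$, the solution $(\boldsymbol\rho_\star,\varphi_\star)\in\mathcal W$ of $A^T_\phi(\boldsymbol\rho_\star,\boldsymbol\eta)+O^T_\phi(\mathbf z;\varphi_\star,\boldsymbol\eta)+B^T(\boldsymbol\eta,\varphi_\star)=F^T(\boldsymbol\eta)$, $B^T(\boldsymbol\rho_\star,\psi)=0$ satisfies $\|\boldsymbol\rho_\star\|_{\epsilon,\Omega}+\|\varphi_\star\|_{\epsilon,6;\Omega}\le\widetilde C_\epsilon\|\varphi_D\|_{1/2+\epsilon,\Gamma_D}$. $((\boldsymbol\sigma,\vec{\mathbf u}),(\boldsymbol\rho,\varphi))\in\mathcal V\times\mathcal W$, $\vec{\mathbf u}=(\mathbf u,\boldsymbol\gamma)$, is the unique solution of (P) with $(\mathbf u,\varphi)\in\mathbf W(R)$, and $((\boldsymbol\sigma_h,\vec{\mathbf u}_h),(\boldsymbol\rho_h,\varphi_h))\in\mathcal V_h\times\mathcal W_h$ is a solution of $(P_h)$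 with $(\mathbf u_h,\varphi_h)\in\mathbf W_{\mathtt d}$ (the data are assumed such that these exist). **Constants $C_1,C_2$.** $C_1,C_2>0$ are $h$-independent constants for which the following partial estimates hold: $\|(\boldsymbol\sigma,\vec{\mathbf u})-(\boldsymbol\sigma_h,\vec{\mathbf u}_h)\|_{\mathcal V}\le C_1\{\mathrm{dist}((\boldsymbol\sigma,\vec{\mathbf u}),\mathcal V_h)+\|\boldsymbol\sigma-\mathcal P^h_r\boldsymbol\sigma\|_{0,\Omega}+\|\boldsymbol\gamma-\mathcal P^h_r\boldsymbol\gamma\|_{0,\Omega}+\|\mathbf u\otimes\mathbf u-\mathcal P^h_r(\mathbf u\otimes\mathbf u)\|_{0,\Omega}+\|\mathbf u\|_{0,6;\Omega}\|\mathbf u-\mathbf u_h\|_{0,6;\Omega}+(1+\|\mathbf g\|_{0,3/2;\Omega}+\|\mathbf u\|_{0,6;\Omega}^2)\|\varphi-\varphi_h\|_{0,6;\Omega}\}$ and $\|(\boldsymbol\rho,\varphi)-(\boldsymbol\rho_h,\varphi_h)\|_{\mathcal W}\le C_2\{\mathrm{dist}((\boldsymbol\rho,\varphi),\mathcal W_h)+(\|\varphi_D\|_{1/2+\epsilon,\Gamma_D}+\|\mathbf u\|_{0,6;\Omega}\|\varphi\|_{0,6;\Omega})\|\varphi-\varphi_h\|_{0,6;\Omega}+\|\varphi\|_{0,6;\Omega}\|\mathbf u-\mathbf u_h\|_{0,6;\Omega}+\|\boldsymbol\rho-\mathcal P^h_r\boldsymbol\rho\|_{0,\Omega}+\|\varphi\mathbf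 u-\mathcal P^h_r(\varphi\mathbf u)\|_{0,\Omega}\}$. *)

(* Defs.v *)
From HB Require Import structures.
From mathcomp Require Import all_boot all_order all_algebra.
From mathcomp Require Import all_classical all_reals all_analysis.
Import Order.TTheory GRing.Theory Num.Theory.
Import numFieldNormedType.Exports.

Set Implicit Arguments.
Unset Strict Implicit.
Unset Printing Implicit Defensive.

Local Open Scope classical_set_scope.
Local Open Scope ring_scope.

(* Points of the plane are pairs; vector and tensor fields take values in
   'rV_2 and 'M_2.  A field on a domain D is a total function whose values
   outside D never matter: every norm, integral and equation is restricted
   to D. *)
Notation pt R := (measurableTypeR R * measurableTypeR R)%type.

Notation leb2 R :=
  ((@lebesgue_measure R) \x (@lebesgue_measure R))%E.

Section Defs.
Context {R : realType}.

Local Notation pt := (pt R).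
Local Notation leb2 := (leb2 R).
Local Notation vec := 'rV[R]_2.
Local Notation ten := 'M[R]_2.

Definition eudist (x y : pt) : R :=
  Num.sqrt ((x.1 - y.1) ^+ 2 + (x.2 - y.2) ^+ 2).

Definition area (D : set pt) : R := fine (leb2 D).

Definition mdot m n (A B : 'M[R]_(m, n)) : R :=
  \sum_(i < m) \sum_(j < n) A i j * B i j.

Definition frob m n (A : 'M[R]_(m, n)) : R := Num.sqrt (mdot A A).

Definition dev (A : ten) : ten := A - (\tr A / 2)%:M.

Definition otimes (z w : vec) : ten := z^T *m w.

Definition rowf (i : 'I_2) (tau : pt -> ten) : pt -> vec :=
  fun x => row i (tau x).

Definition Lp (p : \bar R) (D : set pt) (f : pt -> R) : Prop :=
  f \_ D \in Lfun leb2 p.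

Definition LpM m n (p : \bar R) (D : set pt) (v : pt -> 'M[R]_(m, n)) : Prop :=
  forall i j, Lp p D (fun x => v x i j).

Definition eLnorm (p : R) (D : set pt) (f : pt -> R) : \bar R :=
  'N[leb2]_(p%:E)[EFin \o (f \_ D)].

Definition eLnormM m n (p : R) (D : set pt) (v : pt -> 'M[R]_(m, n)) : \bar R :=
  eLnorm p D (fun x => frob (v x)).

(* Real-valued norms; only applied to members of the corresponding space. *)
Definition Lnm (p : R) (D : set pt) (f : pt -> R) : R := fine (eLnorm p D f).

Definition LnmM m n (p : R) (D : set pt) (v : pt -> 'M[R]_(m, n)) : R :=
  fine (eLnormM p D v).

(* Sobolev-Slobodeckij norm of W^{s,p}(D), 0 < s < 1. *)
Definition eWnormM m n (s p : R) (D : set pt) (v : pt -> 'M[R]_(m, n)) : \bar R :=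
  ((eLnormM p D v `^ p +
   \int[leb2]_(x in D) \int[leb2]_(y in D)
     (frob (v x - v y) `^ p / eudist x y `^ (2 + s * p))%:E) `^ (p^-1)%R)%E.

Definition eWnorm (s p : R) (D : set pt) (f : pt -> R) : \bar R :=
  eWnormM s p D (fun x => (f x)%:M : 'M[R]_1).

Definition line (i : 'I_2) (x : pt) (t : R) : pt :=
  if i == 0 then (t, x.2) else (x.1, t).

Definition coordi (i : 'I_2) (x : pt) : R := if i == 0 then x.1 else x.2.

Definition pd (i : 'I_2) (f : pt -> R) (x : pt) : R :=
  derive1 (fun t : R => f (line i x t)) (coordi i x).

Definition grad (f : pt -> R) (x : pt) : vec := \row_i pd i f x.

Fixpoint Ck (k : nat) (f : pt -> R) : Prop :=
  continuous (f : R * R -> R) /\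
  if k is k'.+1 then
    (forall i x, derivable (fun t : R => f (line i x t)) (coordi i x) 1) /\
    (forall i, Ck k' (pd i f))
  else True.

Definition smooth (f : pt -> R) : Prop := forall k, Ck k f.

Definition testfun (D : set pt) (psi : pt -> R) : Prop :=
  smooth psi /\
  exists K : set pt, [/\ compact (K : set (R * R)), K `<=` D &
    forall x, ~ K x -> psi x = 0].

Definition loc_integrable (D : set pt) (d : pt -> R) : Prop :=
  measurable_fun D d /\
  forall K : set pt, compact (K : set (R * R)) -> K `<=` D ->
    leb2.-integrable K (EFin \o d).

Definition is_wdiv (D : set pt) (eta : pt -> vec) (d : pt -> R) : Prop :=
  loc_integrable D d /\
  forall psi, testfun D psi ->
    \int[leb2]_(x in D) mdot (eta x) (grad psi x) =
    - \int[leb2]_(x in D) (d x * psi x).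

(* A representative of the distributional divergence, when it is a function. *)
Definition wdiv (D : set pt) (eta : pt -> vec) : pt -> R :=
  xget (fun=> 0) [set d | is_wdiv D eta d].

Definition wDiv (D : set pt) (tau : pt -> ten) : pt -> vec :=
  fun x => \row_i wdiv D (rowf i tau) x.

(* rot (eta_1, eta_2) = div (eta_2, - eta_1) *)
Definition is_wrot (D : set pt) (eta : pt -> vec) (d : pt -> R) : Prop :=
  is_wdiv D (fun x => \row_(i < 2) (if i == 0 then eta x 0 1 else - eta x 0 0)) d.

Definition is_wgrad (D : set pt) (v : pt -> R) (G : pt -> vec) : Prop :=
  LpM 2%:E D G /\
  forall psi, testfun D psi -> forall i,
    \int[leb2]_(x in D) (v x * pd i psi x) =
    - \int[leb2]_(x in D) (G x 0 i * psi x).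

Definition H1 (D : set pt) (v : pt -> R) : Prop :=
  Lp 2%:E D v /\ exists G, is_wgrad D v G.

Definition wgrad (D : set pt) (v : pt -> R) : pt -> vec :=
  xget (fun=> 0) [set G | is_wgrad D v G].

Definition eH1norm (D : set pt) (v : pt -> R) : \bar R :=
  ((eLnorm 2 D v `^ 2 + eLnormM 2 D (wgrad D v) `^ 2) `^ (2^-1)%R)%E.

Definition eH1snorm (s : R) (D : set pt) (v : pt -> R) : \bar R :=
  ((eLnorm 2 D v `^ 2 + eWnormM s 2 D (wgrad D v) `^ 2) `^ (2^-1)%R)%E.

(* An open polygonal region together with its oriented boundary edges.  Two
   consecutive edges may be aligned, so that hanging nodes are vertices. *)
Record polygon := Polygon {
  reg :> set pt;
  nedge : nat;
  edge : 'I_nedge -> pt * pt }.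

Definition epar (e : pt * pt) (t : R) : pt :=
  (e.1.1 + t * (e.2.1 - e.1.1), e.1.2 + t * (e.2.2 - e.1.2)).

Definition elen (e : pt * pt) : R := eudist e.1 e.2.

Definition cseg (e : pt * pt) : set pt := [set epar e t | t in `[0, 1]].
Definition oseg (e : pt * pt) : set pt := [set epar e t | t in `]0, 1[].

Definition left_of (e : pt * pt) (y : pt) : Prop :=
  0 < (e.2.1 - e.1.1) * (y.2 - e.1.2) - (e.2.2 - e.1.2) * (y.1 - e.1.1).

Definition bdry (D : set pt) : set pt := closure (D : set (R * R)) `\` D.

(* A bounded polygonal (Lipschitz) domain: the edges cover the boundary,
   meet only at vertices, the region lies locally on the left of each edge
   only, and each vertex has exactly one incoming and one outgoing edge. *)
Definition polygonal (P : polygon) : Prop :=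
  [/\ [/\ open (P : set (R * R)), P !=set0, connected (P : set (R * R)) &
          exists M, forall x, reg P x -> eudist x (0, 0) <= M],
      bdry P = \bigcup_(k in setT) cseg (@edge P k),
      (forall k, (@edge P k).1 <> (@edge P k).2) /\
      (forall k l : 'I_(nedge P), k <> l ->
        oseg (edge k) `&` cseg (edge l) = set0),
      forall (k : 'I_(nedge P)) x, oseg (edge k) x ->
        exists2 d, 0 < d & forall y, eudist x y < d -> reg P y <-> left_of (edge k) y &
      [/\ injective (fun k : 'I_(nedge P) => (edge k).1),
          injective (fun k : 'I_(nedge P) => (edge k).2) &
          forall k : 'I_(nedge P), exists l : 'I_(nedge P),
            (edge k).2 = (edge l).1]].

Definition arc_dom (e : pt * pt) (G : set pt) : set R :=
  [set t | 0 <= t <= 1 /\ G (epar e t)].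

Definition arc_measurable (P : polygon) (G : set pt) : Prop :=
  forall k : 'I_(nedge P),
    measurable (arc_dom (edge k) G : set (measurableTypeR R)).

Definition arc_measurable_fun (P : polygon) (G : set pt) (f : pt -> R) : Prop :=
  forall k : 'I_(nedge P),
    measurable_fun (arc_dom (edge k) G : set (measurableTypeR R))
      (fun t => f (epar (edge k) t)).

Definition eL2arc (P : polygon) (G : set pt) (f : pt -> R) : \bar R :=
  ((\sum_(k < nedge P) (elen (edge k))%:E *
     \int[lebesgue_measure]_(t in arc_dom (edge k) G)
       (f (epar (edge k) t) ^+ 2)%:E) `^ (2^-1)%R)%E.

(* Graph of the trace operator H^1(P) -> L^2(G): closure of the restriction
   of smooth functions. *)
Definition has_trace (P : polygon) (G : set pt) (v psi : pt -> R) : Prop :=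
  exists s : nat -> pt -> R,
    [/\ forall k, smooth (s k),
        (fun k => eLnorm 2 P (fun x => s k x - v x)%R +
           eLnormM 2 P (fun x => grad (s k) x - wgrad P v x)%R)%E @ \oo --> 0%E &
        (fun k => eL2arc P G (fun x => s k x - psi x)) @ \oo --> 0%E].

Definition extends (P : polygon) (G : set pt) (psi v : pt -> R) : Prop :=
  H1 P v /\ has_trace P G v psi.

(* H^{1/2+s}(G) is the space of traces of H^{1+s}(P), with the quotient norm;
   eHhalf is the case s = 0. *)
Definition eHhalf (P : polygon) (G : set pt) (psi : pt -> R) : \bar R :=
  ereal_inf [set eH1norm P v | v in [set v | extends P G psi v]].

Definition eHhalfs (s : R) (P : polygon) (G : set pt) (psi : pt -> R) : \bar R :=
  ereal_inf [set eH1snorm s P v | v in [set v | extends P G psi v]].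

Definition Hhalf (P : polygon) (G : set pt) (psi : pt -> R) : Prop :=
  arc_measurable_fun P G psi /\ (eHhalf P G psi < +oo)%E.

Definition Hhalfs (s : R) (P : polygon) (G : set pt) (psi : pt -> R) : Prop :=
  arc_measurable_fun P G psi /\ (eHhalfs s P G psi < +oo)%E.

(* <eta . n, v>_Gamma by Green's formula. *)
Definition green (P : polygon) (eta : pt -> vec) (v : pt -> R) : R :=
  \int[leb2]_(x in P) (mdot (eta x) (wgrad P v x) + wdiv P eta x * v x).

(* <eta . n, psi>_G, for eta . n = 0 on the rest of the boundary: any
   H^1-extension of psi may be used. *)
Definition bpair (P : polygon) (G : set pt) (eta : pt -> vec) (psi : pt -> R) : R :=
  green P eta (xget (fun=> 0) [set v | extends P G psi v]).

(* The normal trace vanishes on the traces of H^1 functions supported in G. *)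
Definition normal0 (P : polygon) (G : set pt) (eta : pt -> vec) : Prop :=
  forall v, extends P (bdry P `\` G) (fun=> 0) v -> green P eta v = 0.

(* cD is the constant normalizing the norm of H^{1/2}(Gamma_D). *)
Record data := Data {
  Om : polygon;
  GD : set pt;
  GN : set pt;
  gv : pt -> vec;
  phiD : pt -> R;
  cD : R;
  mu : R -> R; mu1 : R; mu2 : R; Lmu : R;
  kap : R -> R; kap1 : R; kap2 : R; Lkap : R }.

Definition Xt := pt -> vec.
Definition XXt := pt -> ten.
Definition Yt := pt -> R.
Definition Zt := ((pt -> vec) * (pt -> ten))%type.
Definition VVt := (XXt * Zt)%type.
Definition WWt := (Xt * Yt)%type.

Definition Xdiv (D : set pt) (eta : pt -> vec) : Prop :=
  exists2 d, is_wdiv D eta d & Lp (6 / 5)%:E D d.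

Definition Xsp (D : data) (eta : Xt) : Prop :=
  [/\ LpM 2%:E (Om D) eta, Xdiv (Om D) eta & normal0 (Om D) (GN D) eta].

Definition XXsp (D : data) (tau : XXt) : Prop :=
  [/\ LpM 2%:E (Om D) tau, forall i, Xdiv (Om D) (rowf i tau) &
      \int[leb2]_(x in Om D) (\tr (tau x)) = 0].

Definition Ysp (D : data) (psi : Yt) : Prop := Lp 6%:E (Om D) psi.

Definition YYsp (D : data) (v : pt -> vec) : Prop := LpM 6%:E (Om D) v.

Definition skew_ae (D : set pt) (om : pt -> ten) : Prop :=
  {ae leb2, forall x, D x -> (om x)^T = - om x}.

Definition ZZsp (D : data) (om : pt -> ten) : Prop :=
  LpM 2%:E (Om D) om /\ skew_ae (Om D) om.

Definition Zsp (D : data) (v : Zt) : Prop := YYsp D v.1 /\ ZZsp D v.2.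
Definition VVsp (D : data) (a : VVt) : Prop := XXsp D a.1 /\ Zsp D a.2.
Definition WWsp (D : data) (b : WWt) : Prop := Xsp D b.1 /\ Ysp D b.2.

Definition nmXX (D : data) (tau : XXt) : R :=
  LnmM 2 (Om D) tau + LnmM (6 / 5) (Om D) (wDiv (Om D) tau).

Definition nmX (D : data) (eta : Xt) : R :=
  LnmM 2 (Om D) eta + Lnm (6 / 5) (Om D) (wdiv (Om D) eta).

Definition nmZ (D : data) (v : Zt) : R :=
  LnmM 6 (Om D) v.1 + LnmM 2 (Om D) v.2.

Definition nmVV (D : data) (a : VVt) : R := nmXX D a.1 + nmZ D a.2.

Definition nmWW (D : data) (b : WWt) : R := nmX D b.1 + Lnm 6 (Om D) b.2.

Definition AS (m : R -> R) (E : set pt) (phi : Yt) (zeta tau : XXt) : R :=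
  \int[leb2]_(x in E) ((m (phi x))^-1 * mdot (dev (zeta x)) (dev (tau x))).

Definition OS (m : R -> R) (E : set pt) (phi : Yt) (z w : pt -> vec)
    (tau : XXt) : R :=
  \int[leb2]_(x in E) ((m (phi x))^-1 * mdot (dev (otimes (z x) (w x))) (tau x)).

Definition AT (k : R -> R) (E : set pt) (phi : Yt) (xi eta : Xt) : R :=
  \int[leb2]_(x in E) ((k (phi x))^-1 * mdot (xi x) (eta x)).

Definition OT (k : R -> R) (E : set pt) (phi : Yt) (z : pt -> vec) (om : Yt)
    (eta : Xt) : R :=
  \int[leb2]_(x in E) ((k (phi x))^-1 * (om x * mdot (z x) (eta x))).

Definition BS (D : data) (tau : XXt) (v : Zt) : R :=
  \int[leb2]_(x in Om D) mdot (v.1 x) (wDiv (Om D) tau x) +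
  \int[leb2]_(x in Om D) mdot (v.2 x) (tau x).

Definition BT (D : data) (eta : Xt) (psi : Yt) : R :=
  \int[leb2]_(x in Om D) (psi x * wdiv (Om D) eta x).

Definition load (D : data) (phi : Yt) (v : pt -> vec) : R :=
  \int[leb2]_(x in Om D) (phi x * mdot (gv D x) (v x)).

Definition FT (D : data) (eta : Xt) : R := bpair (Om D) (GD D) eta (phiD D).

Definition nm_g (D : data) : R := LnmM (3 / 2) (Om D) (gv D).

Definition nmHhalf (D : data) (psi : pt -> R) : R :=
  cD D * fine (eHhalf (Om D) (GD D) psi).

Definition nm_phiD (D : data) : R := nmHhalf D (phiD D).

Definition nm_phiDs (s : R) (D : data) : R :=
  fine (eHhalfs s (Om D) (GD D) (phiD D)).

Definition coefficient (m : R -> R) (m1 m2 L : R) : Prop :=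
  [/\ 0 < m1, 0 < m2, forall t, m1 <= m t <= m2 &
      forall s t, `|m s - m t| <= L * `|s - t|].

Definition valid_data (D : data) : Prop :=
  [/\ polygonal (Om D),
      [/\ bdry (Om D) = GD D `|` GN D,
          arc_measurable (Om D) (GD D) & arc_measurable (Om D) (GN D)],
      coefficient (mu D) (mu1 D) (mu2 D) (Lmu D) /\
      coefficient (kap D) (kap1 D) (kap2 D) (Lkap D),
      LpM +oo%E (Om D) (gv D) /\ Hhalf (Om D) (GD D) (phiD D) &
      0 < cD D /\
      forall psi eta, Hhalf (Om D) (GD D) psi -> Xsp D eta ->
        `|bpair (Om D) (GD D) eta psi| <= nmHhalf D psi * nmX D eta].

Definition solves_S (D : data) (z : pt -> vec) (phi : Yt) (a : VVt) : Prop :=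
  [/\ VVsp D a,
      forall tau, XXsp D tau ->
        AS (mu D) (Om D) phi a.1 tau + OS (mu D) (Om D) phi z a.2.1 tau +
          BS D tau a.2 = 0 &
      forall v, Zsp D v -> BS D a.1 v = - load D phi v.1].

Definition solves_T (D : data) (z : pt -> vec) (phi : Yt) (b : WWt) : Prop :=
  [/\ WWsp D b,
      forall eta, Xsp D eta ->
        AT (kap D) (Om D) phi b.1 eta + OT (kap D) (Om D) phi z b.2 eta +
          BT D eta b.2 = FT D eta &
      forall psi, Ysp D psi -> BT D b.1 psi = 0].

Definition solves_P (D : data) (a : VVt) (b : WWt) : Prop :=
  solves_S D a.2.1 b.2 a /\ solves_T D a.2.1 b.2 b.

Definition dualsup (T : Type) (S : set T) (nm f : T -> R) : \bar R :=
  ereal_sup [set (f y / nm y)%:E | y in [set y | S y /\ nm y != 0]].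

Definition infsupS (D : data) (al : R) : Prop :=
  forall phi, Ysp D phi -> forall a, VVsp D a ->
    ((al * nmVV D a)%:E <= dualsup (VVsp D) (nmVV D)
      (fun y => (AS (mu D) (Om D) phi a.1 y.1 + BS D y.1 a.2 + BS D a.1 y.2)%R))%E.

Definition infsupT (D : data) (al : R) : Prop :=
  forall phi, Ysp D phi -> forall b, WWsp D b ->
    ((al * nmWW D b)%:E <= dualsup (WWsp D) (nmWW D)
      (fun y => (AT (kap D) (Om D) phi b.1 y.1 + BT D y.1 b.2 + BT D b.1 y.2)%R))%E.

Definition radS (D : data) (alS : R) : R :=
  mu1 D * alS / (2 * area (Om D) `^ (1 / 6)).

Definition radT (D : data) (alT : R) : R :=
  kap1 D * alT / (2 * area (Om D) `^ (1 / 6)).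

Definition radW (D : data) (alS alT : R) : R :=
  Num.min (radS D alS) (radT D alT).

Definition ball66 (D : data) (r : R) (z : pt -> vec) (phi : Yt) : Prop :=
  LnmM 6 (Om D) z + Lnm 6 (Om D) phi <= r.

Definition regularityS (D : data) (alS eps C : R) : Prop :=
  forall z phi a, YYsp D z -> Ysp D phi -> LnmM 6 (Om D) z <= radS D alS ->
    solves_S D z phi a ->
    (eWnormM eps 2 (Om D) a.1 + eWnormM eps 6 (Om D) a.2.1 <=
      (C * nm_g D * Lnm 6 (Om D) phi)%:E)%E.

Definition regularityT (D : data) (alT eps C : R) : Prop :=
  forall z phi b, YYsp D z -> Ysp D phi -> LnmM 6 (Om D) z <= radT D alT ->
    solves_T D z phi b ->
    (eWnormM eps 2 (Om D) b.1 + eWnorm eps 6 (Om D) b.2 <=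
      (C * nm_phiDs eps D)%:E)%E.

(* Polynomial functions of degree < d; thus P_l is [Pol l.+1] and
   P_{-1} = {0} is [Pol 0]. *)
Definition Pol (d : nat) (p : pt -> R) : Prop :=
  exists c : nat -> nat -> R, forall x,
    p x = \sum_(i < d) \sum_(j < d - i) c i j * x.1 ^+ i * x.2 ^+ j.

Definition PolM m n (d : nat) (p : pt -> 'M[R]_(m, n)) : Prop :=
  forall i j, Pol d (fun x => p x i j).

Definition l2proj (l : nat) (E : set pt) (v : pt -> R) : pt -> R :=
  xget (fun=> 0) [set p | Pol l.+1 p /\ forall q, Pol l.+1 q ->
    \int[leb2]_(x in E) ((p x - v x) * q x) = 0].

Definition projM m n (l : nat) (E : set pt) (v : pt -> 'M[R]_(m, n))
    : pt -> 'M[R]_(m, n) :=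
  fun x => \matrix_(i, j) l2proj l E (fun y => v y i j) x.

(* The normal trace of eta on the boundary of E is, on the k-th edge, the
   polynomial q k in the parameter t in [0, 1] of the edge. *)
Definition is_ntrace (r : nat) (E : polygon) (eta : Xt)
    (q : 'I_(nedge E) -> {poly R}) : Prop :=
  (forall k, (size (q k) <= r.+1)%N) /\
  forall psi, smooth psi ->
    \int[leb2]_(x in E) (mdot (eta x) (grad psi x) + wdiv E eta x * psi x) =
    \sum_k elen (edge k) * \int[lebesgue_measure]_(t in `[0, 1])
      ((q k).[t] * psi (epar (edge k) t)).

Definition ntrace (r : nat) (E : polygon) (eta : Xt) : 'I_(nedge E) -> {poly R} :=
  xget (fun=> 0) [set q | is_ntrace r eta q].

Arguments ntrace : clear implicits.

Definition XE (r : nat) (E : polygon) (eta : Xt) : Prop :=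
  [/\ LpM 2%:E E eta,
      exists2 p, is_wdiv E eta p & Pol r.+1 p,
      exists2 p, is_wrot E eta p & Pol r p &
      exists q : 'I_(nedge E) -> {poly R}, is_ntrace r eta q].

Definition XXE (r : nat) (E : polygon) (tau : XXt) : Prop :=
  forall i, XE r E (rowf i tau).

Definition is_basis (F : lmodType R) (S : set F) n (b : 'I_n -> F) : Prop :=
  (forall i, S (b i)) /\
  forall v, S v -> exists! c : 'rV[R]_n, v = \sum_i c 0 i *: b i.

(* Bases for the moments: polynomials on each edge; polynomials on E whose
   first element is the constant 1 (not used as a moment); a complement of
   the gradients. *)
Record dofs (ne : nat) := Dofs {
  nbe : nat; be : 'I_ne -> 'I_nbe -> {poly R};
  nbg : nat; bg : 'I_nbg.+1 -> pt -> R;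
  nbp : nat; bp : 'I_nbp -> pt -> vec }.

Arguments be {ne} d _ _.
Arguments bg {ne} d _.
Arguments bp {ne} d _.

Definition valid_dofs (r : nat) (ne : nat) (B : dofs ne) : Prop :=
  [/\ forall k, is_basis [set p : {poly R} | (size p <= r.+1)%N] (be B k),
      is_basis [set p | Pol r.+1 p] (bg B) /\ bg B ord0 = (fun=> 1),
      forall i, PolM r.+1 (bp B i) &
      forall v : pt -> vec, PolM r.+1 v ->
        exists! gc : (pt -> vec) * 'rV[R]_(nbp B),
          (exists2 p, Pol r.+2 p & gc.1 = grad p) /\
          v = gc.1 + \sum_i gc.2 0 i *: bp B i].

Section Moments.
Context (r : nat) (E : polygon) (B : dofs (nedge E)).

Definition mom_edge (k : 'I_(nedge E)) (j : 'I_(nbe B)) (eta : Xt) : R :=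
  elen (edge k) * \int[lebesgue_measure]_(t in `[0, 1])
    ((ntrace r E eta k).[t] * (be B k j).[t]).

Definition mom_grad (j : 'I_(nbg B)) (eta : Xt) : R :=
  \int[leb2]_(x in E) mdot (eta x) (grad (bg B (lift ord0 j)) x).

Definition mom_perp (j : 'I_(nbp B)) (eta : Xt) : R :=
  \int[leb2]_(x in E) mdot (eta x) (bp B j x).

Definition dof_dot (xi eta : Xt) : R :=
  \sum_k \sum_j mom_edge k j xi * mom_edge k j eta +
  \sum_j mom_grad j xi * mom_grad j eta +
  \sum_j mom_perp j xi * mom_perp j eta.

(* l2proj 0 E phi is a constant function, evaluated at the origin. *)
Definition stabT (k : R -> R) (phi : Yt) (xi eta : Xt) : R :=
  `|k (l2proj 0 E phi (0, 0))|^-1 * dof_dot xi eta.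

Definition stabS (m : R -> R) (phi : Yt) (zeta tau : XXt) : R :=
  `|m (l2proj 0 E phi (0, 0))|^-1 *
  \sum_(i < 2) dof_dot (rowf i zeta) (rowf i tau).

End Moments.

Record mesh := Mesh {
  nelt : nat;
  elt : 'I_nelt -> polygon;
  edof : forall k, dofs (nedge (elt k)) }.

Definition diam (E : set pt) : R := sup [set eudist x.1 x.2 | x in E `*` E].

Definition regular_elt (rho : R) (E : polygon) : Prop :=
  (exists c, forall z, eudist c z < rho * diam E ->
     reg E z /\ forall x t, reg E x -> 0 <= t <= 1 -> reg E (epar (z, x) t)) /\
  (forall k : 'I_(nedge E), rho * diam E <= elen (edge k)).

Definition valid_mesh (r : nat) (rho : R) (D : data) (Th : mesh) : Prop :=
  [/\ forall k : 'I_(nelt Th), polygonal (elt k) /\ regular_elt rho (elt k),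
      forall k l : 'I_(nelt Th), k <> l -> reg (elt k) `&` elt l = set0,
      forall k : 'I_(nelt Th), reg (elt k) `<=` Om D,
      closure (Om D : set (R * R)) =
        \bigcup_(k in [set: 'I_(nelt Th)]) closure (elt k : set (R * R)) &
      forall k : 'I_(nelt Th), valid_dofs r (edof k)].

Section Discrete.
Context (r : nat) (D : data) (Th : mesh).

(* The piecewise projection; it is set to 0 on the (null) mesh skeleton. *)
Definition projh m n (v : pt -> 'M[R]_(m, n)) : pt -> 'M[R]_(m, n) :=
  fun x => \sum_(k < nelt Th) \1_(reg (elt k)) x *: projM r (elt k) v x.

Definition projhs (v : pt -> R) : pt -> R :=
  fun x => \sum_(k < nelt Th) \1_(reg (elt k)) x * l2proj r (elt k) v x.

Definition pwPolM m n (v : pt -> 'M[R]_(m, n)) : Prop :=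
  forall k : 'I_(nelt Th), exists2 p, PolM r.+1 p &
    {ae leb2, forall x, reg (elt k) x -> v x = p x}.

Definition pwPol (v : pt -> R) : Prop :=
  forall k : 'I_(nelt Th), exists2 p, Pol r.+1 p &
    {ae leb2, forall x, reg (elt k) x -> v x = p x}.

Definition Xh (eta : Xt) : Prop :=
  Xsp D eta /\ forall k : 'I_(nelt Th), XE r (elt k) eta.

Definition XXh (tau : XXt) : Prop :=
  XXsp D tau /\ forall k : 'I_(nelt Th), XXE r (elt k) tau.

Definition Yh (psi : Yt) : Prop := Ysp D psi /\ pwPol psi.
Definition YYh (v : pt -> vec) : Prop := YYsp D v /\ pwPolM v.
Definition ZZh (om : pt -> ten) : Prop := ZZsp D om /\ pwPolM om.
Definition Zh (v : Zt) : Prop := YYh v.1 /\ ZZh v.2.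
Definition VVh (a : VVt) : Prop := XXh a.1 /\ Zh a.2.
Definition WWh (b : WWt) : Prop := Xh b.1 /\ Yh b.2.

Definition distVV (a : VVt) : R := inf [set nmVV D (a - y) | y in VVh].
Definition distWW (b : WWt) : R := inf [set nmWW D (b - y) | y in WWh].

Definition ASh (phi : Yt) (zeta tau : XXt) : R :=
  \sum_(k < nelt Th)
    (AS (mu D) (elt k) phi (projM r (elt k) zeta) (projM r (elt k) tau) +
     stabS r (edof k) (mu D) phi
       (zeta - projM r (elt k) zeta) (tau - projM r (elt k) tau)).

Definition ATh (phi : Yt) (xi eta : Xt) : R :=
  \sum_(k < nelt Th)
    (AT (kap D) (elt k) phi (projM r (elt k) xi) (projM r (elt k) eta) +
     stabT r (edof k) (kap D) phi
       (xi - projM r (elt k) xi) (eta - projM r (elt k) eta)).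

Definition OSh (phi : Yt) (z w : pt -> vec) (tau : XXt) : R :=
  \sum_(k < nelt Th) OS (mu D) (elt k) phi z w (projM r (elt k) tau).

Definition OTh (phi : Yt) (z : pt -> vec) (om : Yt) (eta : Xt) : R :=
  \sum_(k < nelt Th) OT (kap D) (elt k) phi z om (projM r (elt k) eta).

Definition BSh (tau : XXt) (v : Zt) : R :=
  \sum_(k < nelt Th)
    (\int[leb2]_(x in elt k) mdot (v.1 x) (wDiv (Om D) tau x) +
     \int[leb2]_(x in elt k) mdot (v.2 x) (projM r (elt k) tau x)).

Definition solves_Ph (a : VVt) (b : WWt) : Prop :=
  (VVh a /\ WWh b) /\
  [/\ forall tau, XXh tau ->
        ASh b.2 a.1 tau + OSh b.2 a.2.1 a.2.1 tau + BSh tau a.2 = 0,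
      forall v, Zh v -> BSh a.1 v = - load D b.2 v.1,
      forall eta, Xh eta ->
        ATh b.2 b.1 eta + OTh b.2 a.2.1 b.2 eta + BT D eta b.2 = FT D eta &
      forall psi, Yh psi -> BT D b.1 psi = 0].

Definition infsupSh (al : R) : Prop :=
  forall phi, Yh phi -> forall a, VVh a ->
    ((al * nmVV D a)%:E <= dualsup VVh (nmVV D)
      (fun y => (ASh phi a.1 y.1 + BSh y.1 a.2 + BSh a.1 y.2)%R))%E.

Definition infsupTh (al : R) : Prop :=
  forall phi, Yh phi -> forall b, WWh b ->
    ((al * nmWW D b)%:E <= dualsup WWh (nmWW D)
      (fun y => (ATh phi b.1 y.1 + BT D y.1 b.2 + BT D b.1 y.2)%R))%E.

Definition stab_equiv (c0 c1 : R) : Prop :=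
  forall phi, Yh phi -> forall k : 'I_(nelt Th),
    (forall zeta, XXE r (elt k) zeta -> projM r (elt k) zeta = (fun=> 0) ->
      c0 * AS (mu D) (elt k) phi zeta zeta
        <= stabS r (edof k) (mu D) phi zeta zeta
        <= c1 * AS (mu D) (elt k) phi zeta zeta) /\
    (forall xi, XE r (elt k) xi -> projM r (elt k) xi = (fun=> 0) ->
      c0 * AT (kap D) (elt k) phi xi xi
        <= stabT r (edof k) (kap D) phi xi xi
        <= c1 * AT (kap D) (elt k) phi xi xi).

Definition res_sigma (a : VVt) : R := LnmM 2 (Om D) (a.1 - projh a.1).
Definition res_gamma (a : VVt) : R := LnmM 2 (Om D) (a.2.2 - projh a.2.2).
Definition res_uu (a : VVt) : R :=
  let uu := fun x => otimes (a.2.1 x) (a.2.1 x) in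
  LnmM 2 (Om D) (uu - projh uu).

Definition res_rho (b : WWt) : R := LnmM 2 (Om D) (b.1 - projh b.1).
Definition res_phiu (a : VVt) (b : WWt) : R :=
  let pu := fun x => b.2 x *: a.2.1 x in
  LnmM 2 (Om D) (pu - projh pu).

End Discrete.

End Defs.

Arguments data R : clear implicits.
Arguments mesh R : clear implicits.
Arguments VVt R : clear implicits.
Arguments WWt R : clear implicits.

(* Main.v *)
(* The a priori bounds |phi| <= (2 / alT) |phiD| and |u| <= (2 / alS) |g| |phi|
   in L^6 follow from the inf-sup conditions: since (u, phi) lies in the ball of
   radius R, Hoelder's inequality bounds each convective term by half of the
   inf-sup constant times the norm of the solution, so it is absorbed.  Inserted
   into the two smallness assumptions, these bounds allow the error terms on the
   right-hand sides of the two partial estimates to be absorbed as well. *)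

Require Import Defs.
From mathcomp Require Import all_boot all_order all_algebra.
From mathcomp Require Import all_classical all_reals all_analysis.
From mathcomp Require Import measurable_realfun ess_sup_inf ring lra.
Import Order.TTheory GRing.Theory Num.Theory.
Import numFieldNormedType.Exports.
Local Open Scope classical_set_scope.
Local Open Scope ring_scope.
Set Implicit Arguments.
Unset Strict Implicit.
Unset Printing Implicit Defensive.

(** * Pointwise estimates in the Frobenius inner product *)

Section pointwise.
Context {R : realType}.

Lemma mdot_ge0 m n (A : 'M[R]_(m, n)) : 0 <= mdot A A.
Proof. by apply: sumr_ge0 => i _; apply: sumr_ge0 => j _; rewrite -expr2 sqr_ge0. Qed.

Lemma frob_ge0 m n (A : 'M[R]_(m, n)) : 0 <= frob A.
Proof. exact: sqrtr_ge0. Qed.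

Lemma sqr_frob m n (A : 'M[R]_(m, n)) : frob A ^+ 2 = mdot A A.
Proof. by rewrite /frob sqr_sqrtr ?mdot_ge0. Qed.

Lemma mdotC m n (A B : 'M[R]_(m, n)) : mdot A B = mdot B A.
Proof. by apply: eq_bigr => i _; apply: eq_bigr => j _; rewrite mulrC. Qed.

Lemma mdotDl m n (A B C : 'M[R]_(m, n)) : mdot (A + B) C = mdot A C + mdot B C.
Proof.
rewrite /mdot -big_split /=; apply: eq_bigr => i _.
by rewrite -big_split /=; apply: eq_bigr => j _; rewrite mxE mulrDl.
Qed.

Lemma mdotZl m n c (A B : 'M[R]_(m, n)) : mdot (c *: A) B = c * mdot A B.
Proof.
rewrite /mdot mulr_sumr; apply: eq_bigr => i _; rewrite mulr_sumr.
by apply: eq_bigr => j _; rewrite mxE mulrA.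
Qed.

Lemma mdot0l m n (B : 'M[R]_(m, n)) : mdot 0 B = 0.
Proof. by rewrite -[0](scale0r (0 : 'M[R]_(m, n))) mdotZl mul0r. Qed.

Lemma frob_eq0 m n (A : 'M[R]_(m, n)) : frob A = 0 -> A = 0.
Proof.
move=> A0; apply/matrixP => i j; rewrite mxE.
have : mdot A A = 0 by rewrite -sqr_frob A0 expr0n.
move/eqP; rewrite psumr_eq0; last first.
  by move=> k _; apply: sumr_ge0 => l _; rewrite -expr2 sqr_ge0.
move/allP => /(_ i (mem_index_enum i)) /=.
rewrite psumr_eq0; last by move=> l _; rewrite -expr2 sqr_ge0.
by move/allP => /(_ j (mem_index_enum j)) /=; rewrite mulf_eq0 orbb => /eqP.
Qed.

(* Expand |A|B - |B|A in the Frobenius norm. *)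
Lemma mdot_le m n (A B : 'M[R]_(m, n)) : mdot A B <= frob A * frob B.
Proof.
have [A0|A0] := eqVneq (frob A) 0; first by rewrite A0 (frob_eq0 A0) mdot0l mul0r.
have [B0|B0] := eqVneq (frob B) 0.
  by rewrite B0 (frob_eq0 B0) mdotC mdot0l mulr0.
have AB : 0 < frob A * frob B by rewrite mulr_gt0 ?lt_neqAle ?frob_ge0 ?andbT 1?eq_sym.
have := mdot_ge0 (frob B *: A + (- frob A) *: B).
rewrite mdotDl !mdotZl !(mdotC _ (_ + _)) !mdotDl !mdotZl -!sqr_frob (mdotC B A).
move=> h; rewrite -subr_ge0 -(pmulr_rge0 _ AB).
nra.
Qed.

Lemma norm_mdot_le m n (A B : 'M[R]_(m, n)) : `|mdot A B| <= frob A * frob B.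
Proof.
rewrite ler_norml mdot_le andbT lerNl -mulN1r -mdotZl (le_trans (mdot_le _ _))//.
by rewrite /frob mdotZl (mdotC A) mdotZl mulrA mulrNN !mul1r.
Qed.

(** In dimension two, |A|^2 - |dev A|^2 = (tr A)^2 / 2; in the proof [a + b] is the trace. *)
Lemma frob_dev_le (A : 'M[R]_2) : frob (dev A) <= frob A.
Proof.
rewrite /frob ler_sqrt ?mdot_ge0//.
rewrite /mdot /dev /mxtrace !big_ord_recl !big_ord0 !mxE /=.
have -> : lift ord0 ord0 = 1 :> 'I_2 by apply/val_inj.
rewrite !addr0 /= mulr1n mulr0n.
set a := A _ _; set b := A _ _; set c := A _ _; set d := A _ _.
have : 0 <= (a + b) ^+ 2 by exact: sqr_ge0.
lra.
Qed.

Lemma frob_otimes (z w : 'rV[R]_2) : frob (otimes z w) = frob z * frob w.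
Proof.
rewrite /frob -sqrtrM ?mdot_ge0//; congr Num.sqrt.
rewrite /mdot /otimes !big_ord_recl !big_ord0 !mxE !big_ord_recl !big_ord0 !mxE.
ring.
Qed.

(** Each square is at most |A i j| times the whole sum. The bound carries L^p membership from the
    entries of a field over to its Frobenius norm. *)
Lemma frob_le_sum m n (A : 'M[R]_(m, n)) : frob A <= \sum_i \sum_j `|A i j|.
Proof.
have s0 : 0 <= \sum_i \sum_j `|A i j| by do 2 (apply: sumr_ge0 => ? _).
rewrite -(ler_pXn2r (_ : 0 < 2)%N) ?nnegrE ?frob_ge0// sqr_frob expr2.
rewrite mulr_suml ler_sum// => i _; rewrite mulr_suml ler_sum// => j _.
rewrite (le_trans (ler_norm _))// normrM ler_wpM2l//.
rewrite (bigD1 i)//= (bigD1 j)//= -addrA lerDl addr_ge0 ?sumr_ge0// => k _.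
by apply: sumr_ge0.
Qed.

End pointwise.

(** * Monotonicity of integrals and Hoelder's inequality with general exponents *)

Section measure.
Context d (T : measurableType d) (R : realType).
Variable mu : {measure set T -> \bar R}.
Implicit Types (f g : T -> R) (p q r : R).
Local Notation "'N_ p [ f ]" := (Lnorm mu p (EFin \o f)).

Import HBNNSimple.

(** The integral of a nonnegative function is a supremum over the simple functions below it, and
    those below [f] are below [g]. The argument covers integrands such as the bilinear forms, whose
    measurability is never established. *)
Lemma le_integral_ge0 (D : set T) (f g : T -> \bar R) :
  (forall x, D x -> 0 <= f x)%E -> (forall x, D x -> f x <= g x)%E ->
  (\int[mu]_(x in D) f x <= \int[mu]_(x in D) g x)%E.
Proof.
move=> f0 fg; have g0 x : D x -> (0 <= g x)%E.
  by move=> Dx; exact: le_trans (f0 _ Dx) (fg _ Dx).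
rewrite !ge0_integralE//; apply: ge_ereal_sup => _ [h /= hf <-].
apply: ereal_sup_ubound; exists h => //= x; apply: le_trans (hf x) _.
by rewrite /patch; case: ifPn => // /set_mem /fg.
Qed.

(** The positive and the negative part of [f] both lie below [g], so their integrals P and N lie in
    [0, G], where G is the integral of [g], and |P - N| <= G. *)
Lemma abse_integral_le (D : set T) (f : T -> R) (g : T -> \bar R) :
  (forall x, D x -> `|f x|%:E <= g x)%E ->
  (`|\int[mu]_(x in D) (f x)%:E| <= \int[mu]_(x in D) g x)%E.
Proof.
move=> fg; rewrite integralE; set P := integral _ _ _; set N := integral _ _ _.
have P0 : (0 <= P)%E by apply: integral_ge0.
have N0 : (0 <= N)%E by apply: integral_ge0.
have Pg : (P <= \int[mu]_(x in D) g x)%E.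
  apply: le_integral_ge0 => // x Dx; apply: le_trans (fg x Dx).
  by rewrite funeposE ge_max !lee_fin ler_norm normr_ge0.
have Ng : (N <= \int[mu]_(x in D) g x)%E.
  apply: le_integral_ge0 => // x Dx; apply: le_trans (fg x Dx).
  by rewrite funenegE ge_max !lee_fin normr_ge0 andbT -normrN ler_norm.
move: Pg Ng; case: (\int[mu]_(x in D) g x)%E => [G||] Pg Ng; rewrite ?leey//; last first.
  by move: (le_trans P0 Pg).
case: P P0 Pg => [P||]//; case: N N0 Ng => [N||]//.
rewrite !lee_fin => N0 Ng P0 Pg /=.
by rewrite ler_norml; apply/andP; split; lra.
Qed.

Lemma le_Lnorm p f g : 0 < p -> (forall x, `|f x| <= `|g x|) ->
  ('N_p%:E[f] <= 'N_p%:E[g])%E.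
Proof.
move=> p0 fg; rewrite unlock; apply: gt0_ler_poweR.
- by rewrite invr_ge0 ltW.
- by rewrite in_itv /= leey andbT integral_ge0// => x _; exact: poweR_ge0.
- by rewrite in_itv /= leey andbT integral_ge0// => x _; exact: poweR_ge0.
apply: le_integral_ge0 => x _; first exact: poweR_ge0.
rewrite /= lee_fin ge0_ler_powR ?nnegrE ?normr_ge0//; exact: ltW.
Qed.

(** Both sides equal the integral of |h|^p raised to the power r / p. *)
Lemma Lnorm_powR r p h : 0 < r -> 0 < p ->
  ('N_(p / r)%:E[(fun x => `|h x| `^ r)%R] = 'N_p%:E[h] `^ r)%E.
Proof.
move=> r0 p0; rewrite unlock -poweRrM invf_div (mulrC _ r); congr (_ `^ _)%E.
apply: eq_integral => x _ /=; congr EFin.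
by rewrite ger0_norm ?powR_ge0// -powRrM mulrCA divff ?gt_eqF// mulr1.
Qed.

(** Apply the conjugate case to |f|^r and |g|^r with exponents p / r and q / r, whose reciprocals
    add up to 1, and take r-th roots. *)
Lemma Lnorm_hoelder p q r f g : 0 < p -> 0 < q -> 0 < r ->
  p^-1 + q^-1 = r^-1 -> measurable_fun setT f -> measurable_fun setT g ->
  ('N_r%:E[(f \* g)%R] <= 'N_p%:E[f] * 'N_q%:E[g])%E.
Proof.
move=> p0 q0 r0 pqr mf mg.
have mr (h : T -> R) :
    measurable_fun setT h -> measurable_fun setT (fun x => `|h x| `^ r).
  move=> mh; apply: (measurableT_comp (measurable_powR _)).
  exact: measurableT_comp.
have := @hoelder _ _ _ mu _ _ (p / r) (q / r) (mr _ mf) (mr _ mg).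
rewrite !divr_gt0// !invf_div -mulrDr pqr divff ?gt_eqF// => /(_ isT isT erefl).
rewrite !Lnorm_powR//.
have -> : ((fun x => `|f x| `^ r) \* (fun x => `|g x| `^ r))%R =
    (fun x => `|(f \* g)%R x| `^ r).
  by apply/funext => x /=; rewrite normrM powRM.
(* Writing the exponent 1 as r / r lets [Lnorm_powR] turn the L^1 norm of |fg|^r into the r-th power
   of the L^r norm of fg. *)
rewrite -[X in ('N_X%:E[_] <= _)%E](@divff _ r) ?gt_eqF// Lnorm_powR//.
rewrite -poweRM ?Lnorm_ge0// => h.
rewrite -[leLHS]poweRe1 ?Lnorm_ge0// -[leRHS]poweRe1 ?mule_ge0 ?Lnorm_ge0//.
rewrite -(divff (lt0r_neq0 r0)) !poweRrM.
apply: gt0_ler_poweR => //; first by rewrite invr_ge0 ltW.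
- by rewrite in_itv /= leey andbT poweR_ge0.
- by rewrite in_itv /= leey andbT poweR_ge0.
Qed.

Lemma Lfun_bounded (D : set T) f p : 0 < p -> measurable D -> (mu D < +oo)%E ->
  f \_ D \in Lfun mu +oo%E -> f \_ D \in Lfun mu p%:E.
Proof.
move=> p0 mD muD; rewrite !inE => /andP[/[!inE]/= mf Nf]; apply/andP.
rewrite !inE; split => //=.
(* The essential supremum is defined by cases. On a space of measure zero any bound will do, with
   the whole space as exceptional set. *)
have [M hM] : exists M, \forall x \ae mu, (Num.norm \o (f \_ D)) x <= M.
  move: Nf; rewrite /finite_norm unlock/=; case: ifPn => [_|mu0 _].
    exact: ess_supr_bounded.
  exists 0; exists setT; split => //.
  by apply/eqP; rewrite eq_le measure_ge0 andbT leNgt.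
rewrite /finite_norm unlock/=; apply: poweR_lty.
pose F (x : T) := (`|(f \_ D) x| `^ p)%:E.
have -> : (\int[mu]_x `|((f \_ D) x)%:E| `^ p = \int[mu]_(x in D) `|F x|)%E.
  rewrite [RHS]integral_mkcond; apply: eq_integral => x _; rewrite /F.
  have [xD|xD] := boolP (x \in D).
    by rewrite [RHS]patchT//= [`|_ `^ _|]ger0_norm// powR_ge0.
  by rewrite [RHS]patchN//= patchN//= normr0 powR0// gt_eqF.
apply: (@le_lt_trans _ _ ((M `^ p)%R%:E * mu D)%E); last first.
  by rewrite lte_mul_pinfty// lee_fin powR_ge0.
apply: integral_le_bound => //.
- apply/measurable_EFinP; apply: measurable_funTS.
  apply: (measurableT_comp (measurable_powR _)); exact: measurableT_comp.
- by rewrite lee_fin powR_ge0.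
- apply: filterS hM => x /= xM _; rewrite lee_fin ger0_norm ?powR_ge0//.
  by rewrite ge0_ler_powR ?nnegrE ?normr_ge0 ?(le_trans _ xM)// ltW.
Qed.

End measure.

(** * Lebesgue spaces on planar domains *)

Section plane.
Context {R : realType}.
Local Notation pt := (pt R).
Local Notation leb2 := (leb2 R).
Implicit Types (D : set pt) (p q r c : R) (f g : pt -> R).

(** Measurability refers to the product sigma-algebra, so [D] is written as a countable union of
    open squares with rational centre and half-side. *)
Lemma open_measurable_plane D : open (D : set (R * R)) -> measurable D.
Proof.
move=> oD.
pose B (i : rat * rat * rat) : set pt :=
  `]ratr i.1.1 - ratr i.2, ratr i.1.1 + ratr i.2[ `*`
  `]ratr i.1.2 - ratr i.2, ratr i.1.2 + ratr i.2[.
have -> : D = \bigcup_(i in [set: rat * rat * rat])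
    (if `[< B i `<=` D >] then B i else set0).
  apply/seteqP; split => [x Dx|x [i _]]; last by case: asboolP => // BD /BD.
  have := oD; rewrite openE => /(_ _ Dx) /nbhs_ballP [e /= e0 eD].
  (* A half-side below e / 2 suffices: every point of a square of half-side s around a centre
     s-close to x is within 2s < e of x in each coordinate. *)
  have [s] : exists s : rat, ratr s \in `]0, (e / 2)[.
    by apply: rat_in_itvoo; rewrite divr_gt0.
  rewrite in_itv /= => /andP[s0 se].
  have [t1] : exists t : rat, ratr t \in `](x.1 - ratr s), (x.1 + ratr s)[.
    by apply: rat_in_itvoo; lra.
  have [t2] : exists t : rat, ratr t \in `](x.2 - ratr s), (x.2 + ratr s)[.
    by apply: rat_in_itvoo; lra.
  rewrite !in_itv /= => /andP[? ?] /andP[? ?].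
  exists (t1, t2, s) => //; case: asboolP => [_|]; last first.
    case=> y [/= /[!in_itv] /= /andP[? ?] /andP[? ?]].
    by apply: eD; split; rewrite /ball /= ltr_norml; apply/andP; split; lra.
  by split; rewrite /= in_itv /=; apply/andP; split; lra.
apply: countable_bigcupT_measurable => // i; case: asboolP => // _.
exact: measurableX.
Qed.

Lemma bounded_leb2_lty D M : measurable D ->
  (forall x, D x -> eudist x (0, 0) <= M) -> (leb2 D < +oo)%E.
Proof.
move=> mD DM; pose I : set (measurableTypeR R) := `[(- M), M]%classic.
have mI : measurable (I `*` I) by apply: measurableX; exact: measurable_itv.
have DI : D `<=` I `*` I.
  move=> x /DM; rewrite /eudist /= !subr0 => xM.
  have h (a b : R) : Num.sqrt (a ^+ 2 + b ^+ 2) <= M -> `|a| <= M.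
    by apply: le_trans; rewrite -sqrtr_sqr ler_sqrt ?addr_ge0 ?sqr_ge0// lerDl sqr_ge0.
  split; rewrite /I /= in_itv /= -ler_norml; first exact: h xM.
  by rewrite addrC in xM; exact: h xM.
have le : (leb2 D <= leb2 (I `*` I))%E by apply: le_measure; rewrite ?inE.
apply: le_lt_trans le _.
have -> : leb2 (I `*` I) = (lebesgue_measure I * lebesgue_measure I)%E.
  by apply: product_measure1E; exact: measurable_itv.
rewrite /I lebesgue_measure_itv /=; case: ifP => _.
  by rewrite -EFinB -EFinM ltry.
by rewrite mul0e ltry.
Qed.

Lemma LpP p D f : Lp p%:E D f <->
  measurable_fun setT (f \_ D) /\ (eLnorm p D f < +oo)%E.
Proof.
rewrite /Lp inE; split => [/andP[]|[mf Nf]]; first by rewrite !inE.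
by apply/andP; rewrite !inE.
Qed.

Lemma Lnm_ge0 p D f : 0 <= Lnm p D f.
Proof. exact/fine_ge0/Lnorm_ge0. Qed.

Lemma LnmE p D f : Lp p%:E D f -> eLnorm p D f = (Lnm p D f)%:E.
Proof.
by move=> /LpP[_ Nf]; rewrite /Lnm fineK// ge0_fin_numE// Lnorm_ge0.
Qed.

Lemma Lp_dominated p D f g : 0 < p -> measurable_fun setT (f \_ D) ->
  Lp p%:E D g -> (forall x, D x -> `|f x| <= `|g x|) -> Lp p%:E D f.
Proof.
move=> p0 mf /LpP[_ Ng] fg; apply/LpP; split=> //; apply: le_lt_trans Ng.
apply: le_Lnorm => // x; rewrite /patch.
by case: ifPn => // /set_mem /fg.
Qed.

Lemma Lp_norm p D f : Lp p%:E D f -> Lp p%:E D (fun x => `|f x|).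
Proof.
move=> /LpP[mf Nf]; apply/LpP.
have E : (fun x => `|f x|) \_ D = fun x => `|(f \_ D) x|.
  by apply/funext => x; rewrite /patch; case: ifP => //; rewrite normr0.
split; first by rewrite E; exact: measurableT_comp.
by move: Nf; rewrite /eLnorm E -(Lnorm_abse _ (EFin \o (f \_ D))).
Qed.

Lemma Lnm_norm p D f : Lnm p D (fun x => `|f x|) = Lnm p D f.
Proof.
rewrite /Lnm /eLnorm -[in RHS]Lnorm_abse; congr (fine (Lnorm _ _ _)).
by apply/funext => x; rewrite /patch /=; case: ifP => //; rewrite normr0.
Qed.

Lemma Lp_add p D f g : 1 <= p -> Lp p%:E D f -> Lp p%:E D g ->
  Lp p%:E D (fun x => f x + g x).
Proof.
move=> p1 /LpP[mf Nf] /LpP[mg Ng]; apply/LpP.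
rewrite /eLnorm (_ : _ \_ D = (f \_ D) \+ (g \_ D)); last first.
  by apply/funext => x; rewrite /patch /=; case: ifP => //; rewrite addr0.
split; first exact: measurable_funD.
by apply: le_lt_trans (minkowski_EFin _ mf mg p1) _; exact: lte_add_pinfty.
Qed.

Lemma Lp_sum p D (I : finType) (F : I -> pt -> R) : 1 <= p ->
  (forall i, Lp p%:E D (F i)) -> Lp p%:E D (fun x => \sum_i F i x).
Proof.
move=> p1 lF; elim: (index_enum I) => [|i s IH]; last first.
  by under eq_fun do rewrite big_cons; exact: Lp_add.
under eq_fun do rewrite big_nil.
apply/LpP; have E : (fun=> 0 : R) \_ D = cst 0.
  by apply/funext => x; rewrite /patch; case: ifP.
rewrite /eLnorm E; split; first exact: measurable_cst.
have -> : EFin \o (cst 0 : pt -> R) = cst 0%E by [].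
by rewrite Lnorm0// eqe gt_eqF// (lt_le_trans _ p1).
Qed.

Lemma patchM D f g : (fun x => f x * g x) \_ D = ((f \_ D) \* (g \_ D)).
Proof.
by apply/funext => x; rewrite /patch /=; case: ifP => //; rewrite mulr0.
Qed.

Lemma eLnorm_mul_le p q r D f g : 0 < p -> 0 < q -> 0 < r ->
  p^-1 + q^-1 = r^-1 -> Lp p%:E D f -> Lp q%:E D g ->
  (eLnorm r D (fun x => (f x * g x)%R) <= (Lnm p D f * Lnm q D g)%:E)%E.
Proof.
move=> p0 q0 r0 pqr lf lg; rewrite EFinM -!LnmE// /eLnorm patchM.
by apply: Lnorm_hoelder => //; [case/LpP: lf|case/LpP: lg].
Qed.

Lemma Lp_mul p q r D f g : 0 < p -> 0 < q -> 0 < r -> p^-1 + q^-1 = r^-1 ->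
  Lp p%:E D f -> Lp q%:E D g -> Lp r%:E D (fun x => f x * g x).
Proof.
move=> p0 q0 r0 pqr lf lg; apply/LpP; split; last first.
  exact: le_lt_trans (eLnorm_mul_le p0 q0 r0 pqr lf lg) (ltry _).
by rewrite patchM; apply: measurable_funM; [case/LpP: lf|case/LpP: lg].
Qed.

Lemma Lnm_mul_le p q r D f g : 0 < p -> 0 < q -> 0 < r -> p^-1 + q^-1 = r^-1 ->
  Lp p%:E D f -> Lp q%:E D g ->
  Lnm r D (fun x => f x * g x) <= Lnm p D f * Lnm q D g.
Proof.
move=> p0 q0 r0 pqr lf lg; rewrite -lee_fin -LnmE; first exact: eLnorm_mul_le.
exact: Lp_mul pqr lf lg.
Qed.

Lemma eLnorm_cst1 p D : 0 < p -> measurable D ->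
  eLnorm p D (fun=> 1) = (leb2 D `^ p^-1)%E.
Proof.
move=> p0 mD; rewrite /eLnorm unlock; congr (_ `^ _)%E.
rewrite -[RHS]mul1e -integral_cst// [RHS]integral_mkcond.
apply: eq_integral => x _; rewrite /patch /=.
by case: ifP => _; rewrite ?normr1 ?powR1// normr0 powR0// gt_eqF.
Qed.

Lemma Lp_cst1 p D : 0 < p -> measurable D -> (leb2 D < +oo)%E ->
  Lp p%:E D (fun=> 1).
Proof.
move=> p0 mD D_fin; apply/LpP; rewrite eLnorm_cst1//; split; last exact: poweR_lty.
by apply/(measurable_restrictT _ mD); exact: measurable_cst.
Qed.

Lemma Lnm_cst1 p D : 0 < p -> measurable D -> Lnm p D (fun=> 1) = area D `^ p^-1.
Proof. by move=> p0 mD; rewrite /Lnm eLnorm_cst1// fine_poweR. Qed.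

(** All the forms are estimated through this bound: [f] is the integrand of the form, c comes from
    the coefficient, and [g] is a product of functions in known Lebesgue spaces. *)
Lemma norm_Rintegral_le D f g c : 0 <= c -> Lp 1%:E D g ->
  (forall x, D x -> `|f x| <= c * g x) ->
  `|\int[leb2]_(x in D) f x| <= c * Lnm 1 D g.
Proof.
move=> c0 lg fg; rewrite /Rintegral.
have : (`|\int[leb2]_(x in D) (f x)%:E| <= (c * Lnm 1 D g)%:E)%E.
  rewrite EFinM -LnmE// /eLnorm Lnorm1 -ge0_integralZl_EFin//; last first.
    do 2 apply: measurableT_comp => //; by case/LpP : lg.
  rewrite [leLHS](_ : _ = `|\int[leb2]_x ((f \_ D) x)%:E|)%E.
    apply: abse_integral_le => x _ /=; rewrite lee_fin /patch.
    by case: ifPn => [/set_mem /fg fgx|_]; rewrite ?normr0 ?mulr0//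
      (le_trans fgx)// ler_wpM2l// ler_norm.
  rewrite integral_mkcond; congr (`| _ |)%E; apply: eq_integral => x _.
  by rewrite /patch; case: ifP.
(* In the infinite cases [fine] returns 0, which is below the nonnegative bound. *)
by case: (\int[leb2]_(x in D) (f x)%:E)%E => //= _; rewrite normr0 mulr_ge0// Lnm_ge0.
Qed.

Lemma Lp_frob m n p D (v : pt -> 'M[R]_(m, n)) : 1 <= p ->
  LpM p%:E D v -> Lp p%:E D (fun x => frob (v x)).
Proof.
move=> p1 lv; apply: (@Lp_dominated _ _ _ (fun x => \sum_i \sum_j `|v x i j|)).
- exact: lt_le_trans p1.
(* The extension by zero of the norm is the square root of the sum of squares of the extended
   entries, hence measurable. *)
- rewrite (_ : _ \_ D = fun x => Num.sqrt (\sum_i \sum_j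
    (((fun y => v y i j) \_ D) x * ((fun y => v y i j) \_ D) x))).
    apply: (measurableT_comp (continuous_measurable_fun (@sqrt_continuous R))).
    apply: measurable_sum => i; apply: measurable_sum => j.
    by apply: measurable_funM; case/LpP: (lv i j).
  apply/funext => x; rewrite /patch; case: ifP => // _.
  by rewrite big1 ?sqrtr0// => i _; rewrite big1// => j _; rewrite mulr0.
- by do 2 (apply: Lp_sum => // ?); exact/Lp_norm/lv.
- by move=> x _; rewrite (ger0_norm (frob_ge0 _)) (le_trans (frob_le_sum _))// ler_norm.
Qed.

Lemma valid_Om (D : data R) : valid_data D ->
  measurable (Om D : set pt) /\ (leb2 (Om D) < +oo)%E.
Proof.
case=> -[[oD _ _ [M DM]] _ _ _ _] _ _ _ _.
have mD := open_measurable_plane oD; split => //; exact: bounded_leb2_lty DM.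
Qed.

End plane.

(** * Bounds on the convective and load terms, and the a priori estimates *)

Section apriori.
Context {R : realType}.
Local Notation pt := (pt R).
Local Notation leb2 := (leb2 R).

Lemma dualsup_le (T : Type) (S : set T) (nm f : T -> R) K :
  (forall y, 0 <= nm y) -> (forall y, S y -> `|f y| <= K * nm y) ->
  (dualsup S nm f <= K%:E)%E.
Proof.
move=> nm0 fK; apply: ge_ereal_sup => _ [y [Sy y0] <-].
rewrite lee_fin ler_pdivrMr ?lt_neqAle ?nm0 1?eq_sym ?y0//.
exact: le_trans (ler_norm _) (fK _ Sy).
Qed.

(** Hoelder with 1/6 + 1/6 + 1/6 + 1/2 = 1. The explicit factor 1 is measured in L^6, and this is
    where the power |Omega|^(1/6) in the radius R comes from. *)
Lemma Lp_Lnm_662 (E : set pt) (f g h : pt -> R) :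
  measurable E -> (leb2 E < +oo)%E ->
  Lp 6%:E E f -> Lp 6%:E E g -> Lp 2%:E E h ->
  Lp 1%:E E (fun x => 1 * (f x * g x) * h x) /\
  Lnm 1 E (fun x => 1 * (f x * g x) * h x) <=
    area E `^ (1 / 6) * (Lnm 6 E f * Lnm 6 E g) * Lnm 2 E h.
Proof.
move=> mE E_fin lf lg lh.
have e3 : 6^-1 + 6^-1 = 3^-1 :> R by lra.
have e2 : 6^-1 + 3^-1 = 2^-1 :> R by lra.
have e1 : 2^-1 + 2^-1 = 1^-1 :> R by rewrite invr1; lra.
have l1 : Lp 6%:E E (fun=> 1) by exact: Lp_cst1.
have lfg : Lp 3%:E E (fun x => f x * g x) by exact: Lp_mul lf lg.
have l1fg : Lp 2%:E E (fun x => 1 * (f x * g x)) by exact: Lp_mul l1 lfg.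
split; first exact: Lp_mul l1fg lh.
apply: le_trans (Lnm_mul_le _ _ _ e1 l1fg lh) _ => //.
rewrite ler_wpM2r ?Lnm_ge0//.
apply: le_trans (Lnm_mul_le _ _ _ e2 l1 lfg) _ => //.
rewrite Lnm_cst1// div1r ler_wpM2l ?powR_ge0//.
exact: (Lnm_mul_le _ _ _ e3 lf lg).
Qed.

(** Hoelder with 1/6 + 1/6 + 2/3 = 1, as required by the load term. *)
Lemma Lp_Lnm_663half (E : set pt) (f g h : pt -> R) :
  Lp 6%:E E f -> Lp 6%:E E g -> Lp (3 / 2)%:E E h ->
  Lp 1%:E E (fun x => f x * g x * h x) /\
  Lnm 1 E (fun x => f x * g x * h x) <= Lnm 6 E f * Lnm 6 E g * Lnm (3 / 2) E h.
Proof.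
move=> lf lg lh.
have e3 : 6^-1 + 6^-1 = 3^-1 :> R by lra.
have e1 : 3^-1 + (3 / 2)^-1 = 1^-1 :> R by rewrite invr1; field.
have lfg : Lp 3%:E E (fun x => f x * g x) by exact: Lp_mul lf lg.
split; first by apply: Lp_mul e1 lfg lh; rewrite ?divr_gt0.
apply: le_trans (Lnm_mul_le _ _ _ e1 lfg lh) _; rewrite ?divr_gt0//.
by rewrite ler_wpM2r ?Lnm_ge0//; exact: (Lnm_mul_le _ _ _ e3 lf lg).
Qed.

Lemma norm_invM_le (m1 m a b : R) : 0 < m1 -> m1 <= m -> `|a| <= b ->
  `|m^-1 * a| <= m1^-1 * b.
Proof.
move=> m10 m1m ab; have m0 : 0 < m by exact: lt_le_trans m1m.
rewrite normrM ger0_norm ?invr_ge0 ?(ltW m0)//.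
by rewrite ler_pM ?invr_ge0 ?(ltW m0)// lef_pV2.
Qed.

(** The coefficient contributes 1 / m1, taking the deviator does not increase the norm, and |z (x)
    w| = |z| |w|; the rest is the Hoelder bound with exponents 6, 6, 6, 2. *)
Lemma norm_OS_le (E : set pt) (m : R -> R) m1 phi z w tau :
  measurable E -> (leb2 E < +oo)%E -> 0 < m1 -> (forall t, m1 <= m t) ->
  LpM 6%:E E z -> LpM 6%:E E w -> LpM 2%:E E tau ->
  `|OS m E phi z w tau| <= m1^-1 *
    (area E `^ (1 / 6) * (LnmM 6 E z * LnmM 6 E w) * LnmM 2 E tau).
Proof.
move=> mE E_fin m10 m1m lz lw lt.
have p6 : 1 <= 6 :> R by lra.
have p2 : 1 <= 2 :> R by lra.
have [l1 le1] := Lp_Lnm_662 mE E_fin (Lp_frob p6 lz) (Lp_frob p6 lw) (Lp_frob p2 lt).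
have i0 : 0 <= m1^-1 by rewrite invr_ge0 ltW.
apply: le_trans (norm_Rintegral_le i0 l1 _) (ler_wpM2l i0 le1) => x _.
apply: norm_invM_le => //; apply: le_trans (norm_mdot_le _ _) _.
by rewrite mul1r ler_wpM2r ?frob_ge0// -frob_otimes frob_dev_le.
Qed.

Lemma norm_OT_le (E : set pt) (k : R -> R) k1 phi z om eta :
  measurable E -> (leb2 E < +oo)%E -> 0 < k1 -> (forall t, k1 <= k t) ->
  LpM 6%:E E z -> Lp 6%:E E om -> LpM 2%:E E eta ->
  `|OT k E phi z om eta| <= k1^-1 *
    (area E `^ (1 / 6) * (LnmM 6 E z * Lnm 6 E om) * LnmM 2 E eta).
Proof.
move=> mE E_fin k10 k1k lz lom le.
have p6 : 1 <= 6 :> R by lra.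
have p2 : 1 <= 2 :> R by lra.
have [l1 le1] := Lp_Lnm_662 mE E_fin (Lp_norm lom) (Lp_frob p6 lz) (Lp_frob p2 le).
have i0 : 0 <= k1^-1 by rewrite invr_ge0 ltW.
rewrite (mulrC (LnmM _ _ _)) -(Lnm_norm _ _ om).
apply: le_trans (norm_Rintegral_le i0 l1 _) (ler_wpM2l i0 le1) => x _.
apply: norm_invM_le => //; rewrite normrM mul1r -mulrA ler_wpM2l//.
exact: norm_mdot_le.
Qed.

Lemma nmVV_ge0 (D : data R) a : 0 <= nmVV D a.
Proof. by rewrite !addr_ge0 ?Lnm_ge0. Qed.

Lemma nmWW_ge0 (D : data R) b : 0 <= nmWW D b.
Proof. by rewrite !addr_ge0 ?Lnm_ge0. Qed.

Lemma LnmM2_le_nmVV (D : data R) (a : VVt R) : LnmM 2 (Om D) a.1 <= nmVV D a.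
Proof. by rewrite /nmVV /nmXX -addrA lerDl !addr_ge0 ?Lnm_ge0. Qed.

Lemma LnmM6_le_nmVV (D : data R) (a : VVt R) : LnmM 6 (Om D) a.2.1 <= nmVV D a.
Proof. by rewrite /nmVV /nmZ addrCA lerDl !addr_ge0 ?Lnm_ge0. Qed.

Lemma LnmM2_le_nmWW (D : data R) (b : WWt R) : LnmM 2 (Om D) b.1 <= nmWW D b.
Proof. by rewrite /nmWW /nmX -addrA lerDl !addr_ge0 ?Lnm_ge0. Qed.

Lemma Lnm6_le_nmWW (D : data R) (b : WWt R) : Lnm 6 (Om D) b.2 <= nmWW D b.
Proof. by rewrite /nmWW lerDr !addr_ge0 ?Lnm_ge0. Qed.

Lemma norm_load_le (D : data R) phi v : valid_data D -> Ysp D phi -> YYsp D v ->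
  `|load D phi v| <= nm_g D * Lnm 6 (Om D) phi * LnmM 6 (Om D) v.
Proof.
move=> D_valid lphi lv; have [mD D_fin] := valid_Om D_valid.
have [_ _ _ [lg _] _] := D_valid.
have p6 : 1 <= 6 :> R by lra.
have p3 : 1 <= 3 / 2 :> R by lra.
(* The domain has finite measure, so the essentially bounded field g lies in L^(3/2). *)
have lg' : LpM (3 / 2)%:E (Om D) (gv D).
  by move=> i j; apply: Lfun_bounded (lg i j); rewrite ?divr_gt0.
have [l1 le1] := Lp_Lnm_663half (Lp_norm lphi) (Lp_frob p6 lv) (Lp_frob p3 lg').
rewrite /nm_g -mulrA mulrC -(Lnm_norm _ _ phi).
apply: le_trans le1; rewrite -[leRHS]mul1r.
apply: norm_Rintegral_le => // x _.
rewrite mul1r normrM -mulrA ler_wpM2l// mulrC; exact: norm_mdot_le.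
Qed.

(* For [s = |Omega| ^ (1/6)] the upper bound on [z] is [radS] or [radT].  At
   [s = 0] that bound is the junk value 0, but then the left-hand side is 0. *)
Lemma convection_absorbed (m s z al u t N Y : R) :
  0 < m -> 0 <= s -> 0 <= al -> 0 <= z -> 0 <= u -> 0 <= t ->
  z <= m * al / (2 * s) -> u <= N -> t <= Y ->
  m^-1 * (s * (z * u) * t) <= al / 2 * N * Y.
Proof.
move=> m0 s0 al0 z0 u0 t0 zr uN tY.
have mi0 : 0 <= m^-1 by rewrite invr_ge0 ltW.
have h : m^-1 * (s * z) <= al / 2.
  apply: (@le_trans _ _ (m^-1 * (s * (m * al / (2 * s))))).
    by do 2 apply: ler_wpM2l => //.
  move: s0; rewrite le_eqVlt => /predU1P[<-|s0].
    by rewrite mul0r mulr0 divr_ge0.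
  have -> // : m^-1 * (s * (m * al / (2 * s))) = al / 2.
  by field; rewrite !gt_eqF.
rewrite (_ : m^-1 * _ = m^-1 * (s * z) * u * t); last by ring.
have smz0 : 0 <= m^-1 * (s * z) by rewrite !mulr_ge0.
by apply: ler_pM => //; [rewrite mulr_ge0|exact: ler_pM].
Qed.

Lemma apriori_S (D : data R) alS z phi a : valid_data D -> 0 < alS ->
  infsupS D alS -> YYsp D z -> Ysp D phi -> LnmM 6 (Om D) z <= radS D alS ->
  solves_S D z phi a -> alS * nmVV D a <= 2 * nm_g D * Lnm 6 (Om D) phi.
Proof.
move=> D_valid al0 infS lz lphi zr [aV eq1 eq2].
have [mD D_fin] := valid_Om D_valid.
have [_ _ [[mu0 _ mub _] _] _ _] := D_valid.
set N := nmVV D a; set G := nm_g D * Lnm 6 (Om D) phi.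
(* The convective term costs exactly half of the left-hand side, whence the factor 2 in the
   conclusion. *)
suff h : alS * N <= alS / 2 * N + G by rewrite -mulrA -/G; lra.
rewrite -lee_fin; apply: le_trans (infS _ lphi _ aV) _.
apply: dualsup_le => [y|y yV]; first exact: nmVV_ge0.
have [[lt _ _] [lv lo]] := yV; have [_ [lu _]] := aV.
(* By the two equations the numerator of the inf-sup quotient equals minus the convective term minus
   the load. *)
rewrite eq2//; have /eqP := eq1 y.1 yV.1.
rewrite addrAC addr_eq0 => /eqP ->.
have mu_ge t : mu1 D <= mu D t by case/andP: (mub t).
have hO := norm_OS_le phi mD D_fin mu0 mu_ge lz lu lt.
have hL := norm_load_le D_valid lphi lv.
rewrite (le_trans (ler_normB _ _))// normrN mulrDl lerD//.
- apply: (le_trans hO); apply: convection_absorbed => //;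
    rewrite ?powR_ge0 ?fine_ge0 ?Lnorm_ge0 ?(ltW al0)//.
  + exact: LnmM6_le_nmVV.
  + exact: LnmM2_le_nmVV.
- apply: (le_trans hL); rewrite ler_wpM2l ?LnmM6_le_nmVV//.
  by rewrite mulr_ge0 ?Lnm_ge0.
Qed.

Lemma apriori_T (D : data R) alT z phi b : valid_data D -> 0 < alT ->
  infsupT D alT -> YYsp D z -> Ysp D phi -> LnmM 6 (Om D) z <= radT D alT ->
  solves_T D z phi b -> alT * nmWW D b <= 2 * nm_phiD D.
Proof.
move=> D_valid al0 infT lz lphi zr [bW eq1 eq2].
have [mD D_fin] := valid_Om D_valid.
have [_ _ [_ [k0 _ kb _]] [_ phiDH] [cD0 FTle]] := D_valid.
set N := nmWW D b.
suff h : alT * N <= alT / 2 * N + nm_phiD D by lra.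
rewrite -lee_fin; apply: le_trans (infT _ lphi _ bW) _.
apply: dualsup_le => [y|y yW]; first exact: nmWW_ge0.
have [[le _ _] _] := yW; have [_ lo] := bW.
(* The divergence equation removes the last term, and the first equation turns the others into FT
   minus the convective term. *)
rewrite eq2 ?addr0; last by case: yW.
have := eq1 y.1 yW.1; rewrite addrAC => /(canRL (addrK _)) ->.
have k_ge t : kap1 D <= kap D t by case/andP: (kb t).
have hO := norm_OT_le phi mD D_fin k0 k_ge lz lo le.
have hF := FTle _ _ phiDH yW.1.
have F0 : 0 <= nm_phiD D.
  rewrite /nm_phiD /nmHhalf mulr_ge0 ?(ltW cD0)// fine_ge0// le_ereal_inf_tmp//.
  by move=> _ [v _ <-]; exact: poweR_ge0.
rewrite (le_trans (ler_normB _ _))// addrC mulrDl lerD//.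
- apply: (le_trans hO); apply: convection_absorbed => //;
    rewrite ?powR_ge0 ?fine_ge0 ?Lnorm_ge0 ?(ltW al0)//.
  + exact: Lnm6_le_nmWW.
  + exact: LnmM2_le_nmWW.
- apply: (le_trans hF); rewrite ler_wpM2l//.
  by rewrite /nmWW lerDl Lnm_ge0.
Qed.

Lemma nm_phiDs_ge0 eps (D : data R) : 0 <= nm_phiDs eps D.
Proof.
apply: fine_ge0; apply: le_ereal_inf_tmp => _ [v _ <-]; exact: poweR_ge0.
Qed.

Lemma inf_ge0 (A : set R) : (forall x, A x -> 0 <= x) -> 0 <= inf A.
Proof.
(* By convention [inf] of the empty set is 0. *)
move=> A0; have [->|/set0P An] := eqVneq A set0; first by rewrite inf0.
exact: lb_le_inf.
Qed.

End apriori.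

(* [eS / (4 C1) + eT] is the weighting for which [small2] absorbs all of [eu]
   and [small1] half of [ep]; this bounds [eT], hence then [eS]. *)
Lemma coupled_error_bound (R : realFieldType)
    (C1 C2 eS eT DS DT U F g d eu ep : R) :
  0 < C1 -> 0 < C2 -> 0 <= DS -> 0 <= DT -> 0 <= U -> 0 <= F -> 0 <= g ->
  0 <= d -> 0 <= eu <= eS -> 0 <= ep <= eT ->
  eS <= C1 * (DS + U * eu + (1 + g + U ^+ 2) * ep) ->
  eT <= C2 * (DT + (d + U * F) * ep + F * eu) ->
  1 / 4 * (g + U ^+ 2) + C2 * (d + U * F) <= 1 / 4 ->
  U / 4 + C2 * F / 2 <= 1 / (8 * C1) ->
  eS + eT <= (1 + 4 * C1 + 2 * C2 + 8 * (C1 * C2)) * (DS + DT).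
Proof.
move=> C10 C20 DS0 DT0 U0 F0 g0 d0 /andP[eu0 euS] /andP[ep0 epT] hS hT small1 small2.
have [C1ge C2ge] : 0 <= C1 /\ 0 <= C2 by rewrite !ltW.
have eT0 := le_trans ep0 epT.
have eS0 := le_trans eu0 euS.
(* This bound is kept for the estimate of [eS], where it absorbs half of [eS]. *)
have C1U : C1 * U <= 1 / 2.
  have : C1 * (U / 4 + C2 * F / 2) <= C1 * (1 / (8 * C1)) by rewrite ler_pM2l.
  have -> : C1 * (1 / (8 * C1)) = 1 / 8 by field; rewrite gt_eqF.
  have : 0 <= C1 * (C2 * F) by rewrite !mulr_ge0.
  lra.
(* In the weighted sum [eu] has coefficient U / 4 + C2 F, which this bounds by 1 / (4 C1), the
   weight of [eS]. *)
have C1small : C1 * (U + 4 * (C2 * F)) <= 1.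
  have : C1 * (U / 4 + C2 * F / 2) <= C1 * (1 / (8 * C1)) by rewrite ler_pM2l.
  have -> : C1 * (1 / (8 * C1)) = 1 / 8 by field; rewrite gt_eqF.
  have : 0 <= C1 * U by rewrite mulr_ge0.
  lra.
have gU : g + U ^+ 2 <= 1.
  have : 0 <= C2 * (d + U * F) by rewrite mulr_ge0// addr_ge0 ?mulr_ge0.
  lra.
(* This is the weighted sum multiplied by C1, which keeps it polynomial. The coefficient of [ep] is
   at most 1/4 + 1/4, so half of [eT] remains against DS / 4 + C2 DT. *)
have {}hT : C1 * eT <= C1 * (DS / 2 + 2 * (C2 * DT)).
  have hT' : C1 * eT <= C1 * (C2 * (DT + (d + U * F) * ep + F * eu)) by rewrite ler_pM2l.
  have absorb_ep :
      C1 * ((1 / 4 * (g + U ^+ 2) + C2 * (d + U * F)) * ep) <= C1 * (1 / 4 * eT).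
    rewrite ler_pM2l// ler_pM//.
    by rewrite addr_ge0 ?mulr_ge0 ?addr_ge0 ?mulr_ge0 ?sqr_ge0.
  have absorb_eu : C1 * (U + 4 * (C2 * F)) * eu <= 1 * eS.
    by rewrite ler_pM// !mulr_ge0 ?addr_ge0 ?mulr_ge0.
  have C1ep : C1 * ep <= C1 * eT by rewrite ler_pM2l.
  lra.
have {}hT : eT <= DS / 2 + 2 * (C2 * DT) by rewrite -(ler_pM2l C10).
have {}hS : eS <= 2 * (C1 * (DS + 2 * eT)).
  have absorb_eu : C1 * U * eu <= 1 / 2 * eS by rewrite ler_pM// mulr_ge0.
  have : C1 * ((g + U ^+ 2) * ep) <= C1 * (1 * eT).
    by rewrite ler_pM2l// ler_pM// addr_ge0// sqr_ge0.
  have C1ep : C1 * ep <= C1 * eT by rewrite ler_pM2l.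
  lra.
(* Eliminating [eT] gives eS + eT <= (4 C1 + 1/2) DS + (8 C1 C2 + 2 C2) DT; both coefficients are
   below the stated constant. *)
have : C1 * eT <= C1 * (DS / 2 + 2 * (C2 * DT)) by rewrite ler_pM2l.
have : 0 <= C1 * DT by rewrite mulr_ge0.
have : 0 <= C2 * DS by rewrite mulr_ge0.
have : 0 <= C1 * C2 * DS by rewrite !mulr_ge0.
lra.
Qed.

(** * Absorption of the coupled errors in the two partial estimates *)

Theorem theorem6p2 (R : realType) (C1 C2 : R) (C1_gt0 : 0 < C1) (C2_gt0 : 0 < C2) :
  exists2 Chat : R, 0 < Chat &
  forall (D : data R) (D_valid : valid_data D)
    (alS alT : R) (alS_gt0 : 0 < alS) (alT_gt0 : 0 < alT)
    (infS : infsupS D alS) (infT : infsupT D alT)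
    (I : Type) (r : nat) (rho : R) (rho_gt0 : 0 < rho) (Th : I -> mesh R)
    (Th_valid : forall h, valid_mesh r rho D (Th h))
    (c0 c1 : R) (c0_gt0 : 0 < c0) (c1_gt0 : 0 < c1)
    (stab : forall h, stab_equiv r D (Th h) c0 c1)
    (alSh alTh : R) (alSh_gt0 : 0 < alSh) (alTh_gt0 : 0 < alTh)
    (infSh : forall h, infsupSh r D (Th h) alSh)
    (infTh : forall h, infsupTh r D (Th h) alTh)
    (eps Ceps Ceps' : R) (eps_itv : 1 / 3 <= eps < 1)
    (Ceps_gt0 : 0 < Ceps) (Ceps'_gt0 : 0 < Ceps')
    (phiD_reg : Hhalfs eps (Om D) (GD D) (phiD D))
    (regS : regularityS D alS eps Ceps) (regT : regularityT D alT eps Ceps')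
    (* a = (sigma, (u, gamma)), b = (rho, phi): the solution of (P) *)
    (a : VVt R) (b : WWt R) (ab_sol : solves_P D a b)
    (ab_ball : ball66 D (radW D alS alT) a.2.1 b.2)
    (ab_uniq : forall a' b', solves_P D a' b' ->
       ball66 D (radW D alS alT) a'.2.1 b'.2 ->
       nmVV D (a - a') = 0 /\ nmWW D (b - b') = 0)
    (* ah, bh: a solution of (P_h) *)
    (ah : I -> VVt R) (bh : I -> WWt R)
    (abh_sol : forall h, solves_Ph r D (Th h) (ah h) (bh h))
    (abh_ball : forall h, ball66 D (radW D alSh alTh) (ah h).2.1 (bh h).2)
    (estS : forall h,
       nmVV D (a - ah h) <=
       C1 * (distVV r D (Th h) a + res_sigma r D (Th h) a
             + res_gamma r D (Th h) a + res_uu r D (Th h) a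
             + LnmM 6 (Om D) a.2.1 * LnmM 6 (Om D) (a.2.1 - (ah h).2.1)
             + (1 + nm_g D + LnmM 6 (Om D) a.2.1 ^+ 2)
               * Lnm 6 (Om D) (b.2 - (bh h).2)))
    (estT : forall h,
       nmWW D (b - bh h) <=
       C2 * (distWW r D (Th h) b
             + (nm_phiDs eps D + LnmM 6 (Om D) a.2.1 * Lnm 6 (Om D) b.2)
               * Lnm 6 (Om D) (b.2 - (bh h).2)
             + Lnm 6 (Om D) b.2 * LnmM 6 (Om D) (a.2.1 - (ah h).2.1)
             + res_rho r D (Th h) b + res_phiu r D (Th h) a b))
    (small1 :
       1 / 4 * (1 + 16 / (alS ^+ 2 * alT ^+ 2) * nm_g D * nm_phiD D ^+ 2) * nm_g D
       + C2 * (nm_phiDs eps D + 8 / (alS * alT ^+ 2) * nm_g D * nm_phiD D ^+ 2)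
       <= 1 / 4)
    (small2 :
       1 / (alS * alT) * nm_phiD D * nm_g D + C2 * (1 / alT) * nm_phiD D
       <= 1 / (8 * C1)),
  forall h : I,
    nmVV D (a - ah h) + nmWW D (b - bh h) <=
    Chat * (distVV r D (Th h) a + distWW r D (Th h) b
            + res_sigma r D (Th h) a + res_gamma r D (Th h) a
            + res_uu r D (Th h) a
            + res_rho r D (Th h) b + res_phiu r D (Th h) a b).
Proof.
(* This is the constant of [coupled_error_bound], fixed before the data and the meshes are
   introduced. *)
exists (1 + 4 * C1 + 2 * C2 + 8 * (C1 * C2)).
  by rewrite !addr_gt0 ?mulr_gt0.
move=> D D_valid alS alT alS_gt0 alT_gt0 infS infT I r rho _ Th _ _ _ _ _ _
  _ _ _ _ _ _ eps _ _ _ _ _ _ _ _ a b [solS solT] ab_ball _ ah bh _ _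
  estS estT small1 small2 h.
set U := LnmM 6 (Om D) a.2.1; set F := Lnm 6 (Om D) b.2.
have U0 : 0 <= U by exact: Lnm_ge0.
have F0 : 0 <= F by exact: Lnm_ge0.
have g0 : 0 <= nm_g D by exact: Lnm_ge0.
have [[_ [lu _]] _ _] := solS; have [[_ lphi] _ _] := solT.
(* Since F >= 0, the ball condition on U + F bounds U alone, and R is the minimum of the two radii
   in the a priori estimates. *)
have Urad : U <= radW D alS alT by move: ab_ball; rewrite /ball66 -/U -/F; lra.
have US : U <= radS D alS by apply: le_trans Urad _; rewrite ge_min lexx.
have UT : U <= radT D alT by apply: le_trans Urad _; rewrite ge_min lexx orbT.
(* [Fb] comes from alT F <= 2 |phiD|, and [Ub] from inserting it into alS U <= 2 |g| F. *)
pose Fb := 2 / alT * nm_phiD D; pose Ub := 4 / (alS * alT) * nm_g D * nm_phiD D.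
have F_le : F <= Fb.
  rewrite -(ler_pM2l alT_gt0) (_ : alT * Fb = 2 * nm_phiD D); last first.
    by rewrite /Fb; field; rewrite gt_eqF.
  apply: le_trans (apriori_T D_valid alT_gt0 infT lu lphi UT solT).
  by rewrite ler_pM2l//; exact: Lnm6_le_nmWW.
have U_le : U <= Ub.
  have aU : alS * U <= 2 * nm_g D * F.
    apply: le_trans (apriori_S D_valid alS_gt0 infS lu lphi US solS).
    by rewrite ler_pM2l//; exact: LnmM6_le_nmVV.
  rewrite -(ler_pM2l alS_gt0) (le_trans aU)//.
  rewrite (_ : alS * Ub = 2 * nm_g D * Fb); last first.
    by rewrite /Ub /Fb; field; rewrite !gt_eqF.
  by rewrite ler_wpM2l// mulr_ge0.
have dVV0 : 0 <= distVV r D (Th h) a.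
  by apply: inf_ge0 => _ [y _ <-]; exact: nmVV_ge0.
have dWW0 : 0 <= distWW r D (Th h) b.
  by apply: inf_ge0 => _ [y _ <-]; exact: nmWW_ge0.
have s0 : 0 <= res_sigma r D (Th h) a by exact: Lnm_ge0.
have ga0 : 0 <= res_gamma r D (Th h) a by exact: Lnm_ge0.
have uu0 : 0 <= res_uu r D (Th h) a by exact: Lnm_ge0.
have rho0 : 0 <= res_rho r D (Th h) b by exact: Lnm_ge0.
have pu0 : 0 <= res_phiu r D (Th h) a b by exact: Lnm_ge0.
pose DS := distVV r D (Th h) a + res_sigma r D (Th h) a
           + res_gamma r D (Th h) a + res_uu r D (Th h) a.
pose DT := distWW r D (Th h) b + res_rho r D (Th h) b + res_phiu r D (Th h) a b.
have DE : distVV r D (Th h) a + distWW r D (Th h) b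
            + res_sigma r D (Th h) a + res_gamma r D (Th h) a
            + res_uu r D (Th h) a
            + res_rho r D (Th h) b + res_phiu r D (Th h) a b = DS + DT.
  by rewrite /DS /DT; ring.
have UF_le : U * F <= Ub * Fb by exact: ler_pM.
have UU_le : U ^+ 2 <= Ub ^+ 2 by rewrite !expr2; exact: ler_pM.
(* The numbers 16 and 8 in the first smallness assumption arise as 4^2 in [Ub ^+ 2] and 4 * 2 in
   [Ub * Fb]. *)
have UbE : Ub ^+ 2 =
    16 / (alS ^+ 2 * alT ^+ 2) * nm_g D * nm_phiD D ^+ 2 * nm_g D.
  by rewrite /Ub; field; rewrite !gt_eqF.
have UbFbE : Ub * Fb = 8 / (alS * alT ^+ 2) * nm_g D * nm_phiD D ^+ 2.
  by rewrite /Ub /Fb; field; rewrite !gt_eqF.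
rewrite DE; apply: (@coupled_error_bound _ C1 C2 _ _ DS DT U F (nm_g D)
  (nm_phiDs eps D) (LnmM 6 (Om D) (a.2.1 - (ah h).2.1))
  (Lnm 6 (Om D) (b.2 - (bh h).2))) => //.
- exact: addr_ge0 (addr_ge0 (addr_ge0 dVV0 s0) ga0) uu0.
- exact: addr_ge0 (addr_ge0 dWW0 rho0) pu0.
- exact: nm_phiDs_ge0.
- by rewrite Lnm_ge0; exact: (LnmM6_le_nmVV D (a - ah h)).
- by rewrite Lnm_ge0; exact: (Lnm6_le_nmWW D (b - bh h)).
- by apply: le_trans (estT h) _; rewrite ler_pM2l// -/U -/F /DT; lra.
- apply: le_trans small1; rewrite -UbFbE.
  have -> : 1 / 4 * (1 + 16 / (alS ^+ 2 * alT ^+ 2) * nm_g D * nm_phiD D ^+ 2)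
      * nm_g D = 1 / 4 * (nm_g D + Ub ^+ 2) by rewrite UbE; ring.
  by apply: lerD; rewrite ler_pM2l// lerD2l.
(* The left-hand side of the second assumption is Ub / 4 + C2 Fb / 2, which dominates the same
   expression in U and F. *)
- apply: le_trans small2.
  rewrite (_ : 1 / (alS * alT) * nm_phiD D * nm_g D = Ub / 4); last first.
    by rewrite /Ub; field; rewrite !gt_eqF.
  rewrite (_ : C2 * (1 / alT) * nm_phiD D = C2 * Fb / 2); last first.
    by rewrite /Fb; field; rewrite gt_eqF.
  by rewrite lerD// ler_pM2r ?invr_gt0// ler_pM2l.
Qed.
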